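(* Let $d \geq 1$ and let $S \subseteq \mathbb{R}^d$ be a non-empty subset whose affine hull is all of $\mathbb{R}^d$ (i.e. $\dim(S) = d$). Then the set $S'$ of lattice width directions of $S$ has at most $3^d - 1$ elements. Moreover, $|S'| = 3^d - 1$ if and only if the closure of the convex hull of $S$ is a regular lattice cross-polytope.
   Context: Identify the dual lattice of $\mathbb{Z}^d$ with $(\mathbb{Z}^d)^* \subseteq (\mathbb{R}^d)^*$. For non-empty $S \subseteq \mathbb{R}^d$, let $\mathcal{D}(S)$ be the set of linear functionals $v \in (\mathbb{R}^d)^*$ with $\sup v(S) < \infty$ and $\inf v(S) > -\infty$; for $v \in \mathcal{D}(S)$ put $\mathrm{width}(S,v) = \sup v(S) - \inf v(S)$. Let $\mathcal{L}(S) = \mathcal{D}(S) \cap (\mathbb{Z}^d)^*$. The lattice width of $S$ is $\mathrm{width}(S) = \inf\{\mathrm{width}(S,v) : v \in \mathcal{L}(S)\setminus\{0\}\}$ (equal to $\infty$ if this set is empty), and the set of lattice width directions is $S' = \{v \in \mathcal{L}(S)\setminus\{0\} : \mathrm{width}(S,v) = \mathrm{width}(S)\}$. A regular lattice cross-polytope is a set of the form $\mathrm{conv}\{x \pm \lambda e_1, \dots, x \pm \lambda e_d\}$ for some $x \in \mathbb{R}^d$, $\lambda \in \mathbb{R}$, and some lattice basis $e_1,\dots,e_d$ of $\mathbb{Z}^d$. *)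

(* Defs.v *)
From mathcomp Require Import all_boot all_order all_algebra.
From mathcomp Require Import all_classical all_reals all_analysis.

Set Implicit Arguments.
Unset Strict Implicit.
Unset Printing Implicit Defensive.

Import Order.TTheory GRing.Theory Num.Theory numFieldNormedType.Exports.

Local Open Scope classical_set_scope.
Local Open Scope ring_scope.

Notation functional R d := 'Hom('rV[R]_d, R^o).

Definition Zlattice (R : realType) (d : nat) : set 'rV[R]_d :=
  [set x : 'rV[R]_d | forall i, x 0 i \is a Num.int].

Definition dual_lattice (R : realType) (d : nat) : set (functional R d) :=
  [set v : functional R d | forall z, Zlattice z -> v z \is a Num.int].

Definition sup_over (R : realType) (d : nat) (S : set 'rV[R]_d)
    (v : functional R d) : \bar R :=
  ereal_sup [set (v x : R)%:E | x in S].

Definition inf_over (R : realType) (d : nat) (S : set 'rV[R]_d)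
    (v : functional R d) : \bar R :=
  ereal_inf [set (v x : R)%:E | x in S].

Definition bounded_functionals (R : realType) (d : nat) (S : set 'rV[R]_d) :
    set (functional R d) :=
  [set v | (sup_over S v < +oo)%E /\ (-oo < inf_over S v)%E].

(* Only meaningful for nonempty S and v in bounded_functionals S, where both
   extended reals are finite. *)
Definition width (R : realType) (d : nat) (S : set 'rV[R]_d)
    (v : functional R d) : \bar R :=
  (sup_over S v - inf_over S v)%E.

Definition bounded_lattice_functionals (R : realType) (d : nat)
    (S : set 'rV[R]_d) : set (functional R d) :=
  bounded_functionals S `&` @dual_lattice R d.

(* The infimum of the empty set is +oo. *)
Definition lattice_width (R : realType) (d : nat) (S : set 'rV[R]_d) : \bar R :=
  ereal_inf [set width S v | v in bounded_lattice_functionals S `\ 0].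

Definition width_directions (R : realType) (d : nat) (S : set 'rV[R]_d) :
    set (functional R d) :=
  [set v | (bounded_lattice_functionals S `\ 0) v /\
           width S v = lattice_width S].

Definition affine_set (R : realType) (d : nat) (A : set 'rV[R]_d) : Prop :=
  forall (x y : 'rV[R]_d) (t : R), A x -> A y -> A (t *: x + (1 - t) *: y).

Definition affine_hull (R : realType) (d : nat) (S : set 'rV[R]_d) :
    set 'rV[R]_d :=
  smallest (@affine_set R d) S.

Definition convex_hull (R : realType) (d : nat) (S : set 'rV[R]_d) :
    set 'rV[R]_d :=
  smallest (fun A : set 'rV[R]_d => convex_set A) S.

Definition lattice_basis (R : realType) (d : nat) (e : 'I_d -> 'rV[R]_d) : Prop :=
  (forall i, Zlattice (e i)) /\
  (forall z, Zlattice z ->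
     exists! c : {ffun 'I_d -> int}, z = \sum_(i < d) e i *~ c i).

Definition regular_lattice_cross_polytope (R : realType) (d : nat)
    (P : set 'rV[R]_d) : Prop :=
  exists (x : 'rV[R]_d) (lambda : R) (e : 'I_d -> 'rV[R]_d),
    lattice_basis e /\
    P = convex_hull ([set x + lambda *: e i | i in [set: 'I_d]] `|`
                     [set x - lambda *: e i | i in [set: 'I_d]]).

(* Main.v *)
Require Import Defs.
From mathcomp Require Import all_boot all_order all_algebra.
From mathcomp Require Import all_classical all_reals all_analysis.
From HB Require Import structures.
From mathcomp Require Import zify ring lra.

(** Call w the lattice width.  If two width directions u, v (or 0) agree modulo 3,
    then (u - v) / 3 is a lattice functional of width at most 2w/3, so u = v: this
    gives the bound 3^d - 1.  In the case of equality, N := width / w is a norm on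
    the lattice Z^d of functionals with N >= 1 off 0 whose closed unit ball represents
    all classes modulo 3.  Balanced base-3 expansions with digits in that ball
    show that N takes no value strictly between (3^k - 1)/2 and (3^k + 1)/2; since N
    varies by at most 1 along x, x + u, x + 2u, ... (N u = 1), its directional
    derivatives at u are integral, and repeated differentiation yields an integral
    linear functional phi <= N with phi u = 1.  Induction on ker phi shows that
    the unit ball is {-1,0,1}^d in some lattice basis f_1, ..., f_d.  After moving
    the centre of S, the support function of S equals w/2 at all nonzero points
    of {-1,0,1}^d, which forces conv S to be dense in the cross-polytope on the dual
    basis with radius w/2. *)

Import Order.TTheory GRing.Theory Num.Theory numFieldNormedType.Exports.

Set Implicit Arguments.
Unset Strict Implicit.
Unset Printing Implicit Defensive.

Local Open Scope classical_set_scope.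
Local Open Scope card_scope.
Local Open Scope ring_scope.

(** * Integral sublinear functions *)

Section IntegralSublinear.
Variables (R : archiRealFieldType) (V : zmodType).
Implicit Types p q : V -> R.

(** An integral value below an earlier integral one is lower by at least 1, so [l] allows only
    finitely many drops. After the last one, monotonicity squeezes all later terms between equal
    integral values. *)
Lemma eventually_int (a : nat -> R) (l : R) :
  (forall m, a m.+1 <= a m) -> (forall m, l <= a m) ->
  (forall M, exists2 m, (M <= m)%N & a m \is a Num.int) ->
  exists2 c, c \is a Num.int & exists M, forall m, (M <= m)%N -> a m = c.
Proof.
move=> a_step a_ge a_int.
have a_dec i j : (i <= j)%N -> a j <= a i.
  apply: (homo_leq (r := fun x y => y <= x)) => // x y z xy yz.
  exact: le_trans yz xy.
have [m0 _ m0int] := a_int 0%N.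
have am0 : a m0 <= l + (Num.bound (a m0 - l))%:R.
  by rewrite -lerBlDl; apply/ltW/archi_boundP; rewrite subr_ge0.
move: (Num.bound _) am0 => n am0.
elim: n => [|n IHn] in m0 m0int am0 *.
  exists (a m0) => //; exists m0 => m m0m; apply: le_anti.
  by rewrite a_dec //= (le_trans am0) // addr0.
case: (pselect (exists m, [/\ (m0 <= m)%N, a m \is a Num.int & a m < a m0])).
  move=> [m [m0m mint lt_m]]; apply: (IHn m) => //.
  have : a m + 1 <= a m0.
    move: mint m0int lt_m => /intrP[i ->] /intrP[j ->].
    by rewrite ltr_int -[1]/(1%:~R) -intrD ler_int lezD1.
  move: am0; rewrite -natr1; lra.
move=> a_min; exists (a m0) => //; exists m0 => m m0m; apply: le_anti.
rewrite a_dec //=; have [k mk kint] := a_int m.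
rewrite (le_trans _ (a_dec _ _ mk)) // leNgt; apply/negP => lt_k.
by apply: a_min; exists k; split => //; exact: leq_trans mk.
Qed.

Definition sublinear p :=
  (forall x y, p (x + y) <= p x + p y) /\ (forall x n, p (x *+ n) = p x *+ n).

Lemma sublinear0 p : sublinear p -> p 0 = 0.
Proof. by case=> _ /(_ 0 0%N); rewrite !mulr0n. Qed.

Lemma sublinearN_ge p x : sublinear p -> - p (- x) <= p x.
Proof.
move=> sp; have := (sp.1 x (- x)); rewrite subrr sublinear0 //; lra.
Qed.

(* [q] is the one-sided directional derivative of [p] at [v]; integrality makes
   the limit defining it stabilise. *)
Lemma sublinear_derivative p (v : V) : sublinear p ->
  (forall x M, exists2 m, (M <= m)%N & p (v *+ m + x) - p v *+ m \is a Num.int) ->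
  exists q, [/\ sublinear q, forall x, q x \is a Num.int,
    forall x, q x <= p x & q (- v) <= - p v].
Proof.
move=> [p_add p_hom] p_int.
have /choice[q qP] : forall x, exists c, c \is a Num.int /\
    exists M, forall m, (M <= m)%N -> p (v *+ m + x) - p v *+ m = c.
  move=> x.
  pose a m := p (v *+ m + x) - p v *+ m.
  have [|||c cint cP] := @eventually_int a (- p (- x)); rewrite /a.
  - by move=> m; rewrite !mulrS -addrA; have := p_add v (v *+ m + x); lra.
  - by move=> m; have := p_add (v *+ m + x) (- x); rewrite addrK p_hom; lra.
  - exact: p_int.
  - by exists c.
exists q; split.
- split=> [x y|x n].
    have [_ [Mx qx]] := qP x; have [_ [My qy]] := qP y.
    have [_ [Mxy qxy]] := qP (x + y).
    (* Stage [m + m] for [x + y] is taken because its argument is the sum of the stage [m] arguments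
       for [x] and for [y]. *)
    have [m [mx my mxy]] : exists m, [/\ (Mx <= m)%N, (My <= m)%N & (Mxy <= m + m)%N].
      by exists (Mx + My + Mxy)%N; split; lia.
    rewrite -(qx m) // -(qy m) // -(qxy (m + m)%N) // !mulrnDr addrACA.
    have := p_add (v *+ m + x) (v *+ m + y); lra.
  have [_ [M qx]] := qP x; have [_ [M' qx']] := qP (x *+ n).
  case: n => [|n] in qx' *.
    by rewrite -(qx' M') // mulr0n addr0 p_hom subrr.
  rewrite -(qx (M + M')%N) ?leq_addr // -(qx' ((M + M') * n.+1)%N); last first.
    by rewrite (leq_trans (leq_addl M M')) // leq_pmulr.
  by rewrite mulrnA -mulrnDl p_hom mulrnBl mulrnA.
- by move=> x; have [] := qP x.
- move=> x; have [_ [M qx]] := qP x; rewrite -(qx M) //.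
  by rewrite lerBlDl -p_hom.
(* At stage [M.+1] the argument is [v *+ M], so the value is exactly [- p v]. *)
- have [_ [M qx]] := qP (- v); rewrite -(qx M.+1) //.
  by rewrite mulrSr addrK p_hom mulrSr; lra.
Qed.

(* An integral Hahn-Banach theorem: differentiating successively in the
   directions [s] makes [p] linear on their span. *)
Lemma integral_sublinear_refine p (s : seq V) :
  sublinear p -> (forall x, p x \is a Num.int) ->
  exists q, [/\ sublinear q, forall x, q x \is a Num.int,
    forall x, q x <= p x & {in s, forall v, q (- v) = - q v}].
Proof.
move=> sp pint; elim: s => [|v s [q [sq qint q_le q_lin]]].
  by exists p; split.
have [|q' [sq' q'int q'_le q'v]] := sublinear_derivative (v := v) sq.
  by move=> x M; exists M => //; rewrite rpredB ?rpredMn.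
exists q'; split => //; first by move=> x; exact: le_trans (q_le x).
move=> x; rewrite inE => /predU1P[->|xs]; apply: le_anti.
  have := sublinearN_ge v sq'; have := q'_le v; lra.
have := sublinearN_ge x sq'; have := q'_le x; have := q'_le (- x).
rewrite q_lin //; lra.
Qed.

End IntegralSublinear.

(** * Norms extremal for Minkowski's 3^d theorem *)

Section ExtremalNorms.
Variable R : archiRealFieldType.

(* The closed unit ball contains a representative of every class modulo 3 while
   the open unit ball contains no lattice point but [0]: this is the equality
   case of Minkowski's 3^d theorem. *)
Definition extremal_norm (d : nat) (N : 'rV[int]_d -> R) :=
  [/\ sublinear N, forall x, N (- x) = N x,
      forall x : 'rV[int]_d, x != 0 -> 1 <= N x
    & forall x : 'rV[int]_d, exists b y : 'rV[int]_d, x = b + y *+ 3 /\ N b <= 1].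

Lemma extremal_norm_ge0 d (N : 'rV[int]_d -> R) x : extremal_norm N -> 0 <= N x.
Proof.
move=> [sN symN _ _]; have := sublinearN_ge x sN; rewrite symN; lra.
Qed.

(* Expanding [x] in base 3 with digits in the unit ball. *)
Lemma extremal_norm_gap d (N : 'rV[int]_d -> R) k x : extremal_norm N ->
  2 * N x < 3 ^+ k + 1 -> 2 * N x <= 3 ^+ k - 1.
Proof.
move=> [sN symN N1 Nr]; elim: k x => [|k IHk] x.
  rewrite expr0 => Nx; have [->|/N1] := eqVneq x 0; first by rewrite sublinear0 //; lra.
  lra.
have [b [y [-> Nb]]] := Nr x; rewrite exprS => Nx.
have Ny : N (y *+ 3) = 3 * N y by rewrite sN.2 mulr_natl.
(* The digit [b] moves the norm by at most 1, so [2 * N y < 3 ^+ k + 1]. The induction hypothesis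
   improves this to [3 ^+ k - 1], and adding [b] back costs at most 2. *)
have : 3 * N y <= N (b + y *+ 3) + 1.
  have := sN.1 (- b) (b + y *+ 3); rewrite addKr symN Ny; lra.
have := sN.1 b (y *+ 3); rewrite Ny => h1 h2.
have := IHk y; lra.
Qed.

Lemma pow3S_half k : exists2 c : R, c \is a Num.int & 3 ^+ k + 1 = 2 * c.
Proof.
exists ((3 ^ k).+1./2)%:R; first exact: rpred_nat.
rewrite -natrM mul2n -[in LHS](natrX R 3 k) natr1; congr (_%:R).
by rewrite -[LHS]odd_double_half /= oddX orbT.
Qed.

(** The norm is unbounded along the ray and grows by at most 1 per step, while it skips the open
    interval of length 1 below [(3 ^+ k + 1) / 2]. The first point to reach that upper end therefore
    hits it exactly, and it is an integer because [3 ^+ k] is odd. *)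
Lemma extremal_norm_ray_int d (N : 'rV[int]_d -> R) u x M : extremal_norm N ->
  N u = 1 -> exists2 m, (M <= m)%N & N (u *+ m + x) \is a Num.int.
Proof.
move=> eN Nu; have [sN symN N1 Nr] := eN.
have N_step m : N (u *+ m.+1 + x) <= N (u *+ m + x) + 1.
  by rewrite mulrS -addrA (le_trans (sN.1 _ _)) // Nu [leLHS]addrC.
have N_low m : m%:R - N x <= N (u *+ m + x).
  by have := sN.1 (u *+ m + x) (- x); rewrite addrK sN.2 Nu symN; lra.
have [k Mk] : exists k : nat, 2 * N (u *+ M + x) < 3 ^+ k + 1.
  have := archi_boundP (mulr_ge0 (ler0n R 2) (extremal_norm_ge0 (u *+ M + x) eN)).
  move: (Num.bound _) => k hk; exists k; rewrite (lt_le_trans hk) //.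
  rewrite -natrX natr1 ler_nat ltnW // ltnW // ltnS; exact: ltn_expl.
have exn : exists n, 3 ^+ k + 1 <= 2 * N (u *+ (M + n) + x).
  have := archi_boundP (addr_ge0 (exprn_ge0 k (ler0n R 3)) (extremal_norm_ge0 x eN)).
  move: (Num.bound _) => n hn; exists n.+1.
  have := N_low (M + n.+1)%N; rewrite natrD -natr1.
  have := ler0n R M; have := exprn_ege1 k (ler1n R 3).
  have := extremal_norm_ge0 x eN; lra.
case: (ex_minnP exn) => n hn n_min.
case: n => [|n] in hn n_min; first by rewrite addn0 in hn; lra.
exists (M + n.+1)%N; first exact: leq_addr.
have lt_n : 2 * N (u *+ (M + n) + x) < 3 ^+ k + 1.
  by rewrite ltNge; apply/negP => /n_min; rewrite ltnn.
have le_n := extremal_norm_gap eN lt_n.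
have [c cint ck] := pow3S_half k.
rewrite addnS; suff -> : N (u *+ (M + n).+1 + x) = c by [].
have := N_step (M + n)%N; rewrite addnS in hn *; lra.
Qed.

(** Subadditivity bounds [q] by the linear function with the same values on the basis; the bound at
    [- x] together with [- q (- x) <= q x] gives the reverse inequality. *)
Lemma sublinear_odd_linear d (q : 'rV[int]_d -> R) : sublinear q ->
  (forall i, q (- 'e_i) = - q 'e_i) ->
  forall x, q x = \sum_i (x 0 i)%:~R * q 'e_i.
Proof.
move=> sq q_odd.
have q_sum (I : Type) (r : seq I) (F : I -> 'rV[int]_d) :
    q (\sum_(i <- r) F i) <= \sum_(i <- r) q (F i).
  elim: r => [|i r IHr]; rewrite ?big_nil ?sublinear0 // !big_cons.
  by rewrite (le_trans (sq.1 _ _)) // lerD2l.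
have q_int (n : int) i : q (n *: 'e_i) = n%:~R * q 'e_i.
  rewrite -[n in n *: _]intz scaler_int.
  have [m [->|->]] : exists m : nat, n = m \/ n = - m%:Z by exists (absz n); lia.
    by rewrite -!pmulrn sq.2 mulr_natl.
  by rewrite !mulrNz -!pmulrn -mulNrn sq.2 q_odd mulNr mulr_natl mulNrn.
have q_le x : q x <= \sum_i (x 0 i)%:~R * q 'e_i.
  rewrite {1}(row_sum_delta x) (le_trans (q_sum _ _ _)) //.
  by apply: ler_sum => i _; rewrite q_int.
move=> x; apply: le_anti; rewrite q_le /=.
have := sublinearN_ge x sq; have := q_le (- x).
have -> : \sum_i ((- x) 0 i)%:~R * q 'e_i = - \sum_i (x 0 i)%:~R * q 'e_i.
  by rewrite -sumrN; apply: eq_bigr => i _; rewrite mxE mulrNz mulNr.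
lra.
Qed.

(** The derivative of [N] at [u] exists and is integral because [N] is integral infinitely often
    along each ray in direction [u]. Differentiating further along the coordinate vectors makes it
    linear; [g] is its coefficient column. *)
Lemma extremal_norm_supporting d (N : 'rV[int]_d -> R) u : extremal_norm N ->
  N u = 1 -> exists g : 'cV[int]_d,
    (forall x, ((x *m g) 0 0)%:~R <= N x) /\ (u *m g) 0 0 = 1.
Proof.
move=> eN Nu; have [sN symN N1 Nr] := eN.
have [|p [sp pint pN pu]] := sublinear_derivative (v := u) sN.
  move=> x M; have [m Mm mint] := extremal_norm_ray_int x M eN Nu.
  by exists m => //; rewrite Nu rpredB // rpred_nat.
have [q [sq qint qp q_odd]] :=
  integral_sublinear_refine [seq 'e_i | i : 'I_d] sp pint.
have qE : forall x, q x = \sum_i (x 0 i)%:~R * q 'e_i.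
  apply: sublinear_odd_linear => // i; apply: q_odd.
  by apply: map_f; rewrite mem_enum.
have /choice[g gE] : forall i, exists n : int, q 'e_i = n%:~R.
  by move=> i; apply/intrP.
have qg x : q x = ((x *m \col_i g i) 0 0)%:~R.
  rewrite qE !mxE rmorph_sum; apply: eq_bigr => i _.
  by rewrite !mxE rmorphM /= gE.
exists (\col_i g i); split=> [x|]; first by rewrite -qg (le_trans (qp x)).
(* [q u <= N u = 1], while [q (- u) <= p (- u) <= - N u] forces [q u >= 1]. *)
apply/eqP; rewrite -(eqr_int R) -qg; apply/eqP/le_anti.
have := sublinearN_ge u sq; have := qp (- u); have := qp u; have := pN u.
rewrite Nu in pu *; lra.
Qed.

Lemma extremal_norm_unitmx d (N : 'rV[int]_d -> R) U : extremal_norm N ->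
  U \in unitmx -> extremal_norm (fun x => N (x *m U)).
Proof.
move=> [sN symN N1 Nr] Uu; split.
- split=> [x y|x n]; first by rewrite mulmxDl sN.1.
  by rewrite -scaler_nat -scalemxAl scaler_nat sN.2.
- by move=> x; rewrite mulNmx symN.
- move=> x x0; apply: N1; apply: contraNneq x0 => xU0.
  by rewrite -(mulmxK Uu x) xU0 mul0mx.
- move=> x; have [b [y [xE Nb]]] := Nr (x *m U).
  exists (b *m invmx U), (y *m invmx U); split; last by rewrite mulmxKV.
  by rewrite -[LHS](mulmxK Uu) xE mulmxDl -!scaler_nat -scalemxAl.
Qed.

Definition unit_box d (c : 'rV[int]_d) := forall i, `|c 0 i| <= 1.

Lemma unit_box_mod3 d (x : 'rV[int]_d) :
  exists c z : 'rV[int]_d, unit_box c /\ x = c + z *+ 3.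
Proof.
have /choice[f fP] : forall i, exists ab : int * int,
    `|ab.1| <= 1 /\ x 0 i = ab.1 + 3 * ab.2.
  (* Shifting by 1 before and after the division turns the remainders 0, 1, 2 into -1, 0, 1. *)
  move=> i; pose n := x 0 i + 1; exists ((n %% 3)%Z - 1, (n %/ 3)%Z) => /=.
  have := divz_eq n 3; have := ltz_pmod n (isT : 0 < 3 :> int).
  have := modz_ge0 n (isT : 3 != 0 :> int); rewrite {}/n; lia.
exists (\row_i (f i).1), (\row_i (f i).2); split=> [i|].
  by rewrite mxE; case: (fP i).
by apply/rowP=> i; rewrite mxE mulmxnE !mxE; have [_ ->] := fP i; lia.
Qed.

(** The box point congruent to [x] modulo 3 differs from it by [z *+ 3], of norm at most 2; a
    nonzero [z] would give norm at least 3. *)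
Lemma extremal_norm_box d (N : 'rV[int]_d -> R) x : extremal_norm N ->
  (forall c, unit_box c -> N c <= 1) -> N x <= 1 -> unit_box x.
Proof.
move=> [sN symN N1 Nr] Nbox Nx; have [c [z [cbox xE]]] := unit_box_mod3 x.
have [z0|/N1 Nz] := eqVneq z 0; first by rewrite xE z0 mul0rn addr0.
have := sN.1 (- c) x; rewrite {1}xE addKr symN sN.2 -mulr_natl.
have := Nbox _ cbox; lra.
Qed.

(** Writing [x *+ 2 = b + y *+ 3] with [N b <= 1] gives [3 * N y <= 5]. Since no value lies strictly
    between 1 and 2, [N y <= 1]; so [b] and [y] lie in the box, and the coordinates of [x *+ 2] are
    at most 4. *)
Lemma extremal_norm_box2 d (N : 'rV[int]_d -> R) (x : 'rV[int]_d) i :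
  extremal_norm N -> (forall c, unit_box c -> N c <= 1) -> N x <= 2 ->
  `|x 0 i| <= 2.
Proof.
move=> eN Nbox Nx; have [sN symN N1 Nr] := eN.
have [b [y [xE Nb]]] := Nr (x *+ 2).
have Ny : N y <= 1.
  have := extremal_norm_gap (k := 1) (x := y) eN; rewrite expr1.
  have := sN.1 (- b) (x *+ 2); rewrite {1}xE addKr symN.
  rewrite (sN.2 y 3%N) (sN.2 x 2%N) -(mulr_natl (N y)) -(mulr_natl (N x)).
  lra.
have := extremal_norm_box eN Nbox Ny i; have := extremal_norm_box eN Nbox Nb i.
have /rowP/(_ i) := xE; rewrite !(mxE, mulmxnE).
move: (x 0 i) (b 0 i) (y 0 i) => p q r; lia.
Qed.

(** A supporting functional with value 1 at a lattice point is primitive, so Smith normal form makes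
    it the first coordinate, up to sign, in a suitable basis. *)
Lemma extremal_norm_first_coord d (N : 'rV[int]_(1 + d) -> R) : extremal_norm N ->
  exists2 U, U \in unitmx & forall x : 'rV[int]_(1 + d), `|x 0 0|%:~R <= N (x *m U).
Proof.
move=> eN; have [sN symN N1 Nr] := eN.
(* The unit-ball representative of the class of ['e_0] is nonzero, hence of norm exactly 1. *)
have [u Nu] : exists u, N u = 1.
  have [b [y [xE Nb]]] := Nr 'e_0; exists b; apply: le_anti; rewrite Nb N1 //.
  apply/eqP=> b0; have /rowP/(_ 0) := xE; rewrite b0 !(mxE, mulmxnE) /=; lia.
have [g [gN gu]] := extremal_norm_supporting eN Nu.
have [L Lu [Q Qu [s _ gE]]] := int_Smith_normal_form g.
pose k := s`_0 * Q 0 0.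
have gk (x : 'rV_(1 + d)) : (x *m invmx L *m g) 0 0 = x 0 0 * k.
  rewrite gE -!mulmxA mulKmx // mulmxA mxE big_ord1 mxE big_ord_recl big1; last first.
    by move=> i _; rewrite !mxE /= mulr0n mulr0.
  by rewrite !mxE /= mulr1n addr0 mulrA.
(* [k] divides the value 1 of the functional at [u]. *)
have k1 : `|k| = 1.
  have := gk (u *m L); rewrite mulmxK // gu => /(congr1 absz).
  rewrite abszM => /esym/eqP; rewrite muln_eq1 => /andP[_ /eqP]; lia.
exists (invmx L) => [|x]; first by rewrite unitmx_inv.
have -> : `|x 0 0| = `|(x *m invmx L *m g) 0 0| by rewrite gk normrM k1 mulr1.
have := gN (x *m invmx L); have := gN (- (x *m invmx L)).
rewrite symN mulNmx mxE; case: ger0P => //.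
Qed.

(** Three integers with distinct residues modulo 3 and mutual distances at most 2 are consecutive,
    and [e] is the middle one. Being within 2 of both outer ones means being within 1 of [e]. The
    three cases are the possible cyclic orders. *)
Lemma middle_residue (a0 a1 a2 : int) : (3 %| a0)%Z -> (3 %| a1 - 1)%Z ->
  (3 %| a2 - 2)%Z -> `|a0 - a1| <= 2 -> `|a0 - a2| <= 2 -> `|a1 - a2| <= 2 ->
  exists e, forall z, `|z - a0| <= 2 -> `|z - a1| <= 2 -> `|z - a2| <= 2 ->
    `|z - e| <= 1.
Proof.
move=> /dvdzP[b0 ->] /dvdzP[b1 h1] /dvdzP[b2 h2].
have -> : a1 = b1 * 3 + 1 by lia.
have -> : a2 = b2 * 3 + 2 by lia.
move=> h01 h02 h12.
have [[-> ->]|[[-> ->]|[-> ->]]] : (b1 = b0 /\ b2 = b0) \/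
    ((b1 = b0 /\ b2 = b0 - 1) \/ (b1 = b0 - 1 /\ b2 = b0 - 1)) by lia.
- by exists (b0 * 3 + 1); lia.
- by exists (b0 * 3); lia.
- by exists (b0 * 3 - 1); lia.
Qed.

Lemma row_mx_coord0 d (a : 'M[int]_1) (z : 'rV[int]_d) : row_mx a z 0 0 = a 0 0.
Proof. by rewrite -(row_mxEl a z); congr (row_mx a z _ _); apply/val_inj. Qed.

(** A representative of the class of [(a, z)] in the unit ball has its first coordinate in {-1, 0,
    1} and congruent to [a], hence equal to [a]: every class of [z] is met within the slice over
    [a]. *)
Lemma extremal_norm_residue d (N : 'rV[int]_(1 + d) -> R) (a : 'rV[int]_1)
    (z : 'rV[int]_d) : extremal_norm N ->
  (forall x : 'rV[int]_(1 + d), `|x 0 0|%:~R <= N x) -> unit_box a ->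
  exists b y, z = b + y *+ 3 /\ N (row_mx a b) <= 1.
Proof.
move=> [sN symN N1 Nr] N0 abox; have [b [y [bE Nb]]] := Nr (row_mx a z).
have b0 : `|b 0 0| <= 1 by rewrite -(ler_int R) (le_trans (N0 b)).
have ab : lsubmx b = a.
  apply/rowP=> i; rewrite !ord1 !mxE lshift0.
  have /rowP/(_ 0) := bE; rewrite row_mx_coord0 !(mxE, mulmxnE).
  by move: (a 0 0) (b 0 0) (y 0 0) b0 (abox 0) => p q r; lia.
exists (rsubmx b), (rsubmx y); split; last by rewrite -ab hsubmxK.
by apply/rowP=> i; have /rowP/(_ (rshift 1 i)) := bE; rewrite row_mxEr !(mxE, mulmxnE).
Qed.

Lemma unit_box0 d : unit_box (0 : 'rV[int]_d).
Proof. by move=> i; rewrite mxE. Qed.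

Lemma extremal_norm_kernel d (N : 'rV[int]_(1 + d) -> R) : extremal_norm N ->
  (forall x : 'rV[int]_(1 + d), `|x 0 0|%:~R <= N x) ->
  extremal_norm (fun z => N (row_mx 0 z)).
Proof.
move=> eN N0; have [sN symN N1 Nr] := eN; split.
- split=> [x y|x n]; first by rewrite -[in row_mx _ _](addr0 0) -add_row_mx sN.1.
  rewrite -[in row_mx _ _](mul0rn _ n) -(sN.2 (row_mx 0 x)); congr N.
  apply/rowP=> i; rewrite !(mulmxnE, mxE).
  by case: fintype.split => j; rewrite !(mulmxnE, mxE).
- by move=> x; rewrite -[in row_mx _ _](oppr0) -opp_row_mx symN.
- move=> x x0; apply: N1; apply: contraNneq x0 => /(congr1 rsubmx).
  by rewrite row_mxKr linear0 => ->.
- by move=> x; apply: extremal_norm_residue => //; exact: unit_box0.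
Qed.

(* The slice [N (1, z) <= 1] meets every class modulo 3, and its coordinates
   spread over at most 3 values: it is a translate of the unit box. *)
Lemma extremal_norm_slice d (N : 'rV[int]_(1 + d) -> R) : extremal_norm N ->
  (forall x : 'rV[int]_(1 + d), `|x 0 0|%:~R <= N x) ->
  (forall c, unit_box c -> N (row_mx 0 c) <= 1) ->
  exists e, forall c, unit_box c -> N (row_mx 1 (e + c)) <= 1.
Proof.
move=> eN N0 Nbox; have [sN symN N1 Nr] := eN.
have box1 : unit_box (1 : 'rV[int]_1) by move=> i; rewrite ord1 mxE.
(* The difference of two points of the slice lies in the kernel of the first coordinate and has norm
   at most 2. *)
have spread a b i : N (row_mx 1 a) <= 1 -> N (row_mx 1 b) <= 1 ->
    `|a 0 i - b 0 i| <= 2.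
  move=> Na Nb; have -> : a 0 i - b 0 i = (a - b) 0 i by rewrite !mxE.
  apply: (extremal_norm_box2 _ (extremal_norm_kernel eN N0)) => //.
  rewrite -[in row_mx _ _](subrr 1) -add_row_mx -opp_row_mx.
  by rewrite (le_trans (sN.1 _ _)) // symN; lra.
have /choice[f fP] : forall i : 'I_d, exists e, forall z, N (row_mx 1 z) <= 1 ->
    `|z 0 i - e| <= 1.
  move=> i.
  have res (k : int) : exists2 a, N (row_mx 1 a) <= 1 & (3 %| (a 0 i - k)%R)%Z.
    have [a [y [kE Na]]] := extremal_norm_residue (const_mx k) eN N0 box1.
    exists a => //; apply/dvdzP; exists (- y 0 i).
    have /rowP/(_ i) := kE; rewrite !(mxE, mulmxnE); move: (a 0 i) (y 0 i) => p q; lia.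
  have [[a0 N0a r0] [a1 N1a r1]] := (res 0, res 1); have [a2 N2a r2] := res 2.
  have [||||e eP] := @middle_residue (a0 0 i) (a1 0 i) (a2 0 i) _ r1 r2.
  - by rewrite subr0 in r0.
  - exact: spread.
  - exact: spread.
  - exact: spread.
  by exists e => z Nz; apply: eP; exact: spread.
exists (\row_i f i) => c cbox.
have [a [y [aE Na]]] := extremal_norm_residue (\row_i f i + c) eN N0 box1.
(* Both sides agree modulo 3 and lie within 1 of [f] in each coordinate, so they coincide. *)
suff -> : \row_i f i + c = a by [].
apply/rowP=> i; have /rowP/(_ i) := aE; have := fP i _ Na; have := cbox i.
rewrite !(mxE, mulmxnE); move: (a 0 i) (y 0 i) (c 0 i) (f i) => p q r s; lia.
Qed.

Theorem extremal_norm_cube d (N : 'rV[int]_d -> R) : extremal_norm N ->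
  exists2 U, U \in unitmx & forall c, unit_box c -> N (c *m U) <= 1.
Proof.
elim: d => [|d IHd] in N *; move=> eN.
  exists 1%:M; rewrite ?unitmx1 // => c _.
  by rewrite (thinmx0 (c *m _)) sublinear0 //; case: eN.
have [V Vu NV] := @extremal_norm_first_coord d N eN.
have eNV := extremal_norm_unitmx eN Vu.
have [W Wu NW] := IHd _ (extremal_norm_kernel eNV NV).
pose W1 : 'M[int]_(1 + d) := block_mx 1%:M 0 0 W.
have W1u : W1 \in unitmx by rewrite unitmxE det_lblock det1 mul1r -unitmxE.
have row_W1 (a : 'M[int]_1) z : row_mx a z *m W1 = row_mx a (z *m W).
  by rewrite mul_row_block !mulmx0 mulmx1 addr0 add0r.
have eNW := extremal_norm_unitmx eNV W1u.
have [||e eP] := extremal_norm_slice eNW.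
- move=> x; have := NV (x *m W1).
  by rewrite -{1 3}(hsubmxK x) row_W1 !row_mx_coord0.
- by move=> c cbox; rewrite row_W1 NW.
(* The shear sends [(1, z)] to [(1, e + z)], moving the centre of the upper slice onto the first
   axis and fixing the kernel. The lower slice follows by symmetry of the norm. *)
pose E : 'M[int]_(1 + d) := block_mx 1%:M e 0 1%:M.
have Eu : E \in unitmx by rewrite unitmxE det_ublock !det1 mulr1 unitr1.
exists (E *m W1 *m V); first by rewrite !unitmx_mul Eu W1u.
rewrite -[d.+1]/(1 + d)%N => c cbox.
rewrite !mulmxA -(hsubmxK c) mul_row_block !mulmx1 mulmx0 addr0.
set a := lsubmx c; set z := rsubmx c.
have zbox : unit_box z by move=> i; rewrite mxE.
have [sN symN _ _] := eNW.
have [n aE] : exists n : int, a = n%:M by exists (a 0 0); exact: mx11_scalar.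
have n1 : `|n| <= 1.
  by have /matrixP/(_ 0 0) := aE; rewrite !mxE mulr1n => <-; exact: cbox.
rewrite aE mul_scalar_mx {aE}.
have [->|[->|->]] : n = 1 \/ n = 0 \/ n = -1 by lia.
- by rewrite scale1r; exact: eP.
- by rewrite scale0r add0r raddf0 row_W1 NW.
- rewrite raddfN scaleN1r -(opprK z) -opprD -opp_row_mx symN; apply: eP => i.
  by rewrite mxE normrN.
Qed.

End ExtremalNorms.

(** * Lattice functionals and their oscillation *)

Section Functionals.
Variables (R : realType) (d : nat).
Implicit Types (v : functional R d) (z : 'rV[int]_d) (x y : 'rV[R]_d).

Definition dot (a x : 'rV[R]_d) : R^o := \sum_i x 0 i * a 0 i.

Lemma dot_linear a : linear (dot a).
Proof.
move=> k x y; rewrite /dot scaler_sumr -big_split /=; apply: eq_bigr => i _.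
by rewrite !mxE mulrDl -mulrA.
Qed.

HB.instance Definition _ a :=
  GRing.isLinear.Build R 'rV[R]_d R^o *:%R (dot a) (dot_linear a).

Definition intfun z : functional R d := linfun (dot (map_mx intr z)).

Lemma intfunE z x : intfun z x = \sum_i x 0 i * (z 0 i)%:~R :> R.
Proof. by rewrite lfunE /=; apply: eq_bigr => i _; rewrite !mxE. Qed.

Lemma intfunD z1 z2 : intfun (z1 + z2) = intfun z1 + intfun z2.
Proof.
apply/lfunP => x; rewrite add_lfunE !intfunE -big_split; apply: eq_bigr => i _.
by rewrite mxE rmorphD mulrDr.
Qed.

Lemma intfun0 : intfun 0 = 0.
Proof. by apply: (addrI (intfun 0)); rewrite -intfunD !addr0. Qed.

Lemma intfunN z : intfun (- z) = - intfun z.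
Proof. by apply: (addrI (intfun z)); rewrite -intfunD !subrr intfun0. Qed.

Lemma intfunMn z n : intfun (z *+ n) = intfun z *+ n.
Proof.
by elim: n => [|n IHn]; rewrite ?mulr0n ?intfun0 // !mulrS intfunD IHn.
Qed.

Lemma intfun_delta z i : intfun z 'e_i = (z 0 i)%:~R :> R.
Proof.
rewrite intfunE (bigD1 i) //= big1 => [|j ji]; first by rewrite mxE !eqxx mul1r addr0.
by rewrite mxE (negPf ji) mul0r.
Qed.

Lemma intfun_inj : injective intfun.
Proof.
by move=> z1 z2 z12; apply/rowP=> i; apply/eqP; rewrite -(eqr_int R) -!intfun_delta z12.
Qed.

Lemma functional_coord v x : v x = \sum_i x 0 i * v 'e_i :> R.
Proof.
rewrite {1}(row_sum_delta x) linear_sum.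
by apply: eq_bigr => i _; rewrite linearZ.
Qed.

Lemma Zlattice_map z : Zlattice (map_mx intr z : 'rV[R]_d).
Proof. by move=> i; rewrite mxE intr_int. Qed.

Lemma ZlatticeP x : Zlattice x -> exists z, x = map_mx intr z.
Proof.
move=> xint; have /choice[z zE] : forall i, exists n : int, x 0 i = n%:~R.
  by move=> i; apply/intrP.
by exists (\row_i z i); apply/rowP=> i; rewrite !mxE.
Qed.

Lemma dual_latticeP v : dual_lattice v <-> exists z, v = intfun z.
Proof.
split=> [vint|[z ->] y yint]; last first.
  by rewrite intfunE rpred_sum // => i _; rewrite rpredM ?intr_int.
have [z zE] : exists z, \row_i (v 'e_i : R) = map_mx intr z.
  apply: ZlatticeP => i; rewrite mxE; apply: vint => j.
  by rewrite mxE; case: (_ && _).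
exists z; apply/lfunP => x; rewrite functional_coord intfunE.
by apply: eq_bigr => i _; have /rowP/(_ i) := zE; rewrite !mxE => ->.
Qed.

End Functionals.

(** * Real-valued bounds on the width *)

Section Oscillation.
Variables (R : realType) (d : nat).
Implicit Types (S : set 'rV[R]_d) (v : functional R d) (r : R).

(** Expresses [width S v <= r] without suprema or extended reals; it also implies that [v] is
    bounded on a nonempty [S]. *)
Definition osc_le S v r := forall x y, S x -> S y -> (v x : R) - v y <= r.

Lemma osc_leD S v v' r r' : osc_le S v r -> osc_le S v' r' ->
  osc_le S (v + v') (r + r').
Proof.
by move=> vr vr' x y Sx Sy; rewrite !add_lfunE opprD addrACA lerD ?vr ?vr'.
Qed.

Lemma osc_leN S v r : osc_le S v r -> osc_le S (- v) r.
Proof.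
move=> vr x y Sx Sy; rewrite !opp_lfunE; have := vr y x Sy Sx.
by rewrite opprK addrC.
Qed.

Lemma osc_leZ S v r k : osc_le S v r -> osc_le S (k *: v) (`|k| * r).
Proof.
wlog k0 : k v / 0 <= k => [wlk vr|vr x y Sx Sy].
  have [/wlk|k0] := leP 0 k; first exact.
  rewrite -[k *: v]opprK -scaleNr -scalerN -normrN.
  by apply: wlk; [rewrite oppr_ge0 ltW | exact: osc_leN].
rewrite !scale_lfunE ger0_norm // -[X in X <= _]mulrBr.
by rewrite ler_wpM2l // vr.
Qed.

Lemma osc_le_width S v : S !=set0 -> bounded_functionals S v ->
  exists w, width S v = w%:E /\ forall r, osc_le S v r <-> w <= r.
Proof.
move=> [x0 Sx0] []; rewrite /width.
have ubS x : S x -> ((v x : R)%:E <= sup_over S v)%E.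
  by move=> Sx; apply: ereal_sup_ubound; exists x.
have lbS x : S x -> (inf_over S v <= (v x : R)%:E)%E.
  by move=> Sx; apply: ereal_inf_lbound; exists x.
case supE : (sup_over S v) (ubS x0 Sx0) => [s| |] // _ _.
case infE : (inf_over S v) (lbS x0 Sx0) => [i| |] // _ _.
exists (s - i); split=> // r; split=> [vr|sir x y Sx Sy]; last first.
  have := ubS x Sx; have := lbS y Sy; rewrite supE infE !lee_fin; lra.
have s_le y : S y -> s <= r + v y.
  move=> Sy; rewrite -lee_fin -supE; apply: ge_ereal_sup => _ [x Sx <-].
  by rewrite lee_fin -lerBlDr vr.
rewrite lerBlDl -lerBlDr -lee_fin -infE; apply: le_ereal_inf_tmp => _ [y Sy <-].
by rewrite lee_fin lerBlDl s_le.
Qed.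

Lemma osc_le_bounded S v r : S !=set0 -> osc_le S v r -> bounded_functionals S v.
Proof.
move=> [x0 Sx0] vr; split.
  apply: (@le_lt_trans _ _ (r + v x0)%:E); last by rewrite ltry.
  apply: ge_ereal_sup => _ [x Sx <-].
  by rewrite lee_fin -lerBlDr vr.
apply: (@lt_le_trans _ _ ((v x0 : R) - r)%:E); first by rewrite ltNyr.
apply: le_ereal_inf_tmp => _ [x Sx <-].
by rewrite lee_fin lerBlDl -lerBlDr vr.
Qed.

(** The lattice width as a real number that is attained or is to be shown attained. By the second
    clause, [osc_le S v w] in the first one amounts to equality of the width with [w]. *)
Definition is_lattice_width S (w : R) :=
  (forall v, width_directions S v <-> [/\ dual_lattice v, v <> 0 & osc_le S v w]) /\
  (forall v r, dual_lattice v -> v <> 0 -> osc_le S v r -> w <= r).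

Lemma width_directions_attained S v0 : S !=set0 -> width_directions S v0 ->
  exists w, is_lattice_width S w.
Proof.
move=> S0 [[[bv0 iv0] v00] wv0].
have [w [wE oscw]] := osc_le_width S0 bv0.
have w_min v r : dual_lattice v -> v <> 0 -> osc_le S v r -> w <= r.
  move=> iv nv0 vr; have bv := osc_le_bounded S0 vr.
  have [w' [w'E oscw']] := osc_le_width S0 bv.
  apply: le_trans (_ : w' <= r); last exact/oscw'.
  rewrite -lee_fin -wE -w'E wv0; apply: ereal_inf_lbound; exists v => //.
exists w; split=> // v; split=> [[[[bv iv] nv0] wv]|[iv nv0 vw]].
  split=> //; have [w' [w'E oscw']] := osc_le_width S0 bv.
  by apply/oscw'; rewrite -lee_fin -w'E wv -wv0 wE.
have bv := osc_le_bounded S0 vw; split=> //.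
have [w' [w'E oscw']] := osc_le_width S0 bv.
rewrite w'E -wv0 wE; congr _%:E; apply: le_anti; rewrite (iffLR (oscw' _)) //=.
by apply: (w_min v) => //; apply/oscw'.
Qed.

Lemma is_lattice_widthP S v0 w : S !=set0 ->
  (forall v r, dual_lattice v -> v <> 0 -> osc_le S v r -> w <= r) ->
  dual_lattice v0 -> v0 <> 0 -> osc_le S v0 w -> is_lattice_width S w.
Proof.
move=> S0 w_min iv0 v00 v0w.
have bv0 := osc_le_bounded S0 v0w; have [w0 [w0E oscw0]] := osc_le_width S0 bv0.
have w0w : w0 = w.
  by apply: le_anti; rewrite (iffLR (oscw0 _)) //= (w_min v0) //; apply/oscw0.
have : width_directions S v0.
  split=> //; apply: le_anti; apply/andP; split; last first.
    by apply: ereal_inf_lbound; exists v0.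
  apply: le_ereal_inf_tmp => _ [v [[bv iv] nv0] <-].
  have [w' [-> oscw']] := osc_le_width S0 bv.
  by rewrite w0E w0w lee_fin (w_min v) //; apply/oscw'.
move=> /(width_directions_attained S0)[w1 [dw1 min1]].
suff -> : w = w1 by [].
have [_ _ v0w1] : [/\ dual_lattice v0, v0 <> 0 & osc_le S v0 w1].
  apply/dw1; split=> //; apply: le_anti; apply/andP; split; last first.
    by apply: ereal_inf_lbound; exists v0.
  apply: le_ereal_inf_tmp => _ [v [[bv iv] nv0] <-].
  have [w' [-> oscw']] := osc_le_width S0 bv.
  by rewrite w0E w0w lee_fin (w_min v) //; apply/oscw'.
by apply: le_anti; rewrite (w_min v0) //= (min1 v0).
Qed.

(** A functional constant on [S] is constant on the affine hull, since its level sets are affine;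
    here the hull contains 0. *)
Lemma osc_le0 S v : S !=set0 -> affine_hull S = [set: 'rV[R]_d] ->
  osc_le S v 0 -> v = 0.
Proof.
move=> [x0 Sx0] hullS v0.
have vE x : v x = v x0.
  have : affine_hull S x by rewrite hullS.
  apply: (@smallest_sub _ _ S [set y | v y = v x0]) => [y z t /= vy vz|y Sy /=].
    by rewrite linearD !linearZ /= vy vz -scalerDl addrC subrK scale1r.
  by apply: le_anti; have := v0 y x0 Sy Sx0; have := v0 x0 y Sx0 Sy; lra.
by apply/lfunP => x; rewrite zero_lfunE vE -(vE 0) linear0.
Qed.

Lemma osc_le_ge0 S v r : S !=set0 -> osc_le S v r -> 0 <= r.
Proof. by move=> [x Sx] /(_ x x Sx Sx); rewrite subrr. Qed.

End Oscillation.

(** * Width directions modulo 3 *)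

Lemma card_finpred (T : finType) (P : pred T) : ([set x | P x] #= `I_#|P|)%card.
Proof.
have -> : [set x | P x] = (@enum_val T P) @` setT.
  apply/seteqP; split=> [x Px|_ [i _ <-]]; last exact: (enum_valP i).
  by exists (enum_rank_in Px x) => //; rewrite enum_rankK_in.
apply: card_eq_trans (card_esym card_II).
by apply: inj_card_eq => i j _ _; exact: enum_val_inj.
Qed.

Lemma card_nonzero_F3 d :
  ([set c : 'rV['F_3]_d | c != 0] #= `I_(3 ^ d - 1))%card.
Proof.
have := card_finpred (predC1 (0%R : 'rV['F_3]_d)).
rewrite cardC1 card_mx card_Fp // mul1n subn1; apply.
Qed.

Lemma intr_F3_eq0 (n : int) : n%:~R = 0 :> 'F_3 -> (3 %| n)%Z.
Proof.
have key (m : nat) : m%:R = 0 :> 'F_3 -> (3 %| m)%N.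
  by move=> /eqP; rewrite -(dvdn_pcharf (pchar_Fp (isT : prime 3))).
case: n => m; first exact: key.
rewrite NegzE rmorphN /= => /eqP; rewrite oppr_eq0 => /eqP/key.
by rewrite dvdzE abszN.
Qed.

Section ModThree.
Variables (R : realType) (d : nat).
Implicit Types (S : set 'rV[R]_d) (z : 'rV[int]_d).

Definition red3 z : 'rV['F_3]_d := map_mx intr z.

Lemma red3_eq0 z : red3 z = 0 -> exists y, z = y *+ 3.
Proof.
move=> z0; have /choice[y yE] : forall i, exists k, z 0 i = k * 3.
  move=> i; apply/dvdzP/intr_F3_eq0.
  by have /rowP/(_ i) := z0; rewrite !mxE.
by exists (\row_i y i); apply/rowP=> i; rewrite mulmxnE mxE yE mulr_natr.
Qed.

Lemma intfun_neq0 z : z != 0 -> intfun R z <> 0.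
Proof. by move=> /eqP z0; rewrite -(intfun0 R d) => /intfun_inj. Qed.

Lemma osc_le_red3_inj S (w : R) z1 z2 : 0 < w -> is_lattice_width S w ->
  osc_le S (intfun R z1) w -> osc_le S (intfun R z2) w -> red3 z1 = red3 z2 ->
  z1 = z2.
Proof.
move=> w0 [_ w_min] z1w z2w z12.
have [y yE] : exists y, z1 - z2 = y *+ 3.
  by apply: red3_eq0; rewrite [red3 _]map_mxB [map_mx _ z1]z12; exact: subrr.
have [y0|/intfun_neq0 y0] := eqVneq y 0.
  by apply/eqP; rewrite -subr_eq0 yE y0 mul0rn.
have : osc_le S (intfun R y) (`|3^-1| * (w + w)).
  have -> : intfun R y = 3^-1 *: (intfun R z1 - intfun R z2).
    rewrite -intfunN -intfunD yE intfunMn -(scaler_nat 3 (intfun R y)).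
    by rewrite scalerA mulVf ?scale1r.
  by apply: osc_leZ; apply: osc_leD => //; exact: osc_leN.
move=> /w_min -/(_ _ y0); rewrite ger0_norm ?invr_ge0 // => h.
have h1 : w <= 3^-1 * (w + w) by apply: h; apply/dual_latticeP; exists y.
exfalso; lra.
Qed.

Lemma width_directions_pos S v0 : S !=set0 -> affine_hull S = [set: 'rV[R]_d] ->
  width_directions S v0 -> exists2 w, 0 < w & is_lattice_width S w.
Proof.
move=> S0 hullS Sv0; have [w wP] := width_directions_attained S0 Sv0.
exists w => //; have [_ v00 v0w] := (wP.1 _).1 Sv0.
rewrite lt_neqAle (osc_le_ge0 S0 v0w) andbT; apply/eqP => w0.
by apply: v00; apply: (osc_le0 S0 hullS); rewrite w0.
Qed.

Lemma width_directions_red3 S : S !=set0 -> affine_hull S = [set: 'rV[R]_d] ->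
  exists2 A : set 'rV['F_3]_d, width_directions S #= A &
    A `<=` [set c | c != 0] /\
    (forall c, A c -> exists2 z, c = red3 z & width_directions S (intfun R z)).
Proof.
move=> S0 hullS; pose T := [set z | width_directions S (intfun R z)].
exists (red3 @` T); last first.
  split=> [_ [z Tz <-]|_ [z Tz <-]]; last by exists z.
  have [w w0 wP] := width_directions_pos S0 hullS Tz.
  have [_ z0 zw] := (wP.1 _).1 Tz; apply/eqP => rz0; apply: z0.
  suff -> : z = 0 by rewrite intfun0.
  (* The zero functional also has oscillation at most [w], so injectivity modulo 3 applies to the
     pair [z], [0] and excludes the zero class. *)
  apply: (osc_le_red3_inj w0 wP zw) => [x y _ _|].
    by rewrite intfun0 !zero_lfunE subrr ltW.
  by rewrite rz0 /red3 map_mx0.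
have -> : width_directions S = (@intfun R d) @` T.
  apply/seteqP; split=> [v Sv|_ [z Tz <-]] //.
  by have [[[_ /dual_latticeP[z vz]] _] _] := Sv; exists z; rewrite /T /= -?vz.
apply: card_eq_trans (inj_card_eq _) (card_esym (inj_card_eq _)).
  by move=> z1 z2 _ _; exact: intfun_inj.
move=> z1 z2; rewrite !inE => T1 T2.
have [w w0 wP] := width_directions_pos S0 hullS T1.
have [_ _ z1w] := (wP.1 _).1 T1; have [_ _ z2w] := (wP.1 _).1 T2.
exact: (osc_le_red3_inj w0 wP).
Qed.

Lemma width_directions_card_le S : S !=set0 -> affine_hull S = [set: 'rV[R]_d] ->
  width_directions S #<= `I_(3 ^ d - 1).
Proof.
move=> S0 hullS; have [A SA [A0 _]] := width_directions_red3 S0 hullS.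
rewrite (card_le_eql SA) -(card_le_eqr (card_nonzero_F3 d)).
exact: subset_card_le.
Qed.

(** Pigeonhole: reduction modulo 3 is injective on width directions, so if it missed a nonzero class
    [c], its image would lie in a set with one element too few. *)
Lemma width_directions_red3_surj S (c : 'rV['F_3]_d) : S !=set0 ->
  affine_hull S = [set: 'rV[R]_d] -> width_directions S #= `I_(3 ^ d - 1) ->
  c != 0 -> exists2 z, c = red3 z & width_directions S (intfun R z).
Proof.
move=> S0 hullS; have [A SA [A0 AP]] := width_directions_red3 S0 hullS.
rewrite (card_eql SA) => cardA c0; apply: AP; apply: contrapT => Ac.
pose P := [pred x : 'rV['F_3]_d | (x != 0) && (x != c)].
have : A #<= [set x | P x].
  apply: subset_card_le => x Ax /=; rewrite (A0 x Ax) /=.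
  by apply/eqP => xc; apply: Ac; rewrite -xc.
rewrite (card_le_eql cardA) (card_le_eqr (card_finpred P)) card_le_II.
have /card_eq_II <- : (`I_#|predC1 (0%R : 'rV['F_3]_d)| #= `I_(3 ^ d - 1))%card.
  by rewrite -(card_eql (card_finpred _)); exact: card_nonzero_F3.
rewrite (cardD1 c (predC1 0)) !inE c0 add1n.
have -> : #|P| = #|[predD1 predC1 (0%R : 'rV['F_3]_d) & c]|.
  by apply: eq_card => x; rewrite !inE andbC.
by rewrite ltnn.
Qed.

End ModThree.

(** * The width as an extremal norm *)

Section WidthCube.
Variables (R : realType) (d : nat).
Implicit Types (S : set 'rV[R]_d) (z : 'rV[int]_d).

Lemma intfunZ (k : int) z : intfun R (k *: z) = k%:~R *: intfun R z.
Proof.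
apply/lfunP => x; rewrite scale_lfunE !intfunE scaler_sumr.
by apply: eq_bigr => i _; rewrite mxE rmorphM mulrCA.
Qed.

Lemma osc_le_lincomb S (n : nat) (M : 'M[int]_(n, d)) :
  (forall i, exists r, osc_le S (intfun R (row i M)) r) ->
  forall y : 'rV[int]_n, exists r, osc_le S (intfun R (y *m M)) r.
Proof.
move=> Mr y; rewrite mulmx_sum_row.
elim/big_rec: _ => [|i z _ [r zr]].
  by exists 0 => x x' _ _; rewrite intfun0 !zero_lfunE subrr.
have [r' Mir'] := Mr i; rewrite intfunD intfunZ.
by exists (`|(y 0 i)%:~R| * r' + r); apply: osc_leD => //; exact: osc_leZ.
Qed.

(* A matrix congruent to the identity modulo 3 is invertible over the reals. *)
Lemma osc_le_all S :
  (forall i, exists2 z, 'e_i = red3 z & exists r, osc_le S (intfun R z) r) ->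
  forall z, exists r, osc_le S (intfun R z) r.
Proof.
move=> Sz; have /choice[f fP] : forall i, exists z, 'e_i = red3 z /\
    exists r, osc_le S (intfun R z) r.
  by move=> i; have [z] := Sz i; exists z.
pose M := \matrix_i f i.
have detM : \det M != 0.
  apply/eqP=> detM; have := det_map_mx (intr : int -> 'F_3) M.
  have -> : map_mx (intr : int -> 'F_3) M = 1%:M.
    apply/row_matrixP => i; rewrite -map_row rowK row1.
    exact: esym (fP i).1.
  by rewrite detM det1 => /eqP; rewrite oner_eq0.
(* The adjugate yields the multiple [\det M *: z] as an integral combination of the rows of [M]; the
   determinant is divided out afterwards over [R]. *)
move=> z; have [|r] := @osc_le_lincomb S d M _ (z *m \adj M).
  by move=> i; rewrite rowK; case: (fP i).
rewrite -mulmxA mul_adj_mx mul_mx_scalar intfunZ => zr.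
have := osc_leZ (\det M)%:~R^-1 zr.
rewrite scalerA mulVf ?intr_eq0 // scale1r => {}zr; eexists; exact: zr.
Qed.

Lemma lattice_width_cube S : (1 <= d)%N -> S !=set0 ->
  affine_hull S = [set: 'rV[R]_d] -> width_directions S #= `I_(3 ^ d - 1) ->
  exists2 w : R, 0 < w /\ is_lattice_width S w &
  exists2 U : 'M[int]_d, U \in unitmx &
    forall c, unit_box c -> osc_le S (intfun R (c *m U)) w.
Proof.
move=> d1 S0 hullS cardS.
have surj c := @width_directions_red3_surj R d S c S0 hullS cardS.
have [z1 _ Sz1] : exists2 z, const_mx 1 = red3 z & width_directions S (intfun R z).
  apply: surj; apply/eqP => /rowP/(_ (Ordinal d1)); rewrite !mxE => /eqP.
  by rewrite oner_eq0.
have [w w0 wP] := width_directions_pos S0 hullS Sz1; exists w => //.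
have [wdP w_min] := wP.
(* Each class ['e_i] modulo 3 contains a width direction, which makes every lattice functional
   bounded on [S] and the width a real-valued function [rho]. *)
have all_bd : forall z, exists r, osc_le S (intfun R z) r.
  apply: osc_le_all => i; have [|z zE Sz] := surj 'e_i.
    apply/eqP => /rowP/(_ i); rewrite !mxE !eqxx => /eqP; by rewrite oner_eq0.
  by exists z => //; exists w; case: ((wdP _).1 Sz).
have /choice[rho rhoP] : forall z, exists rho, forall r,
    osc_le S (intfun R z) r <-> rho <= r.
  move=> z; have [r zr] := all_bd z.
  by have [rho [_ rhoP]] := osc_le_width S0 (osc_le_bounded S0 zr); exists rho.
have rho_osc z : osc_le S (intfun R z) (rho z) by exact/rhoP.
have rho0 : rho 0 = 0.
  apply: le_anti; rewrite (osc_le_ge0 S0 (rho_osc 0)) andbT; apply/rhoP => x y _ _.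
  by rewrite intfun0 !zero_lfunE subrr.
pose N z := w^-1 * rho z.
have N_le z r : (N z <= r) = (rho z <= r * w) by rewrite ler_pdivrMl // mulrC.
have eN : extremal_norm N.
  split.
  - split=> [x y|x n].
      rewrite N_le mulrDl /N ![w^-1 * _]mulrC !divfK ?gt_eqF //.
      by apply/rhoP; rewrite intfunD; exact: osc_leD.
    rewrite /N -mulrnAr; congr (_ * _); case: n => [|n]; first by rewrite mulr0n rho0.
    have n0 : 0 < n.+1%:R :> R by rewrite ltr0n.
    apply: le_anti; apply/andP; split.
      apply/rhoP; rewrite intfunMn; have := osc_leZ n.+1%:R (rho_osc x).
      by rewrite ger0_norm ?ltW // scaler_nat mulr_natl.
    rewrite -mulr_natl -ler_pdivlMl //; apply/rhoP.
    have -> : intfun R x = n.+1%:R^-1 *: intfun R (x *+ n.+1).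
      by rewrite intfunMn -(scaler_nat n.+1 (intfun R x)) scalerA mulVf ?scale1r ?gt_eqF.
    have := osc_leZ n.+1%:R^-1 (rho_osc (x *+ n.+1)).
    by rewrite ger0_norm // invr_ge0 ltW.
  - have le_N x : N (- x) <= N x.
      by rewrite /N ler_pM2l ?invr_gt0 //; apply/rhoP; rewrite intfunN; exact: osc_leN.
    by move=> x; apply: le_anti; rewrite le_N -{1}(opprK x) le_N.
  - move=> x x0; rewrite /N ler_pdivlMl // mulr1.
    apply: (w_min (intfun R x)) => //; last exact: intfun_neq0.
    by apply/dual_latticeP; exists x.
  (* The zero class is represented by 0, every other class by a width direction. *)
  - move=> x; have [x0|x0] := eqVneq (red3 x) 0.
      have [y ->] := red3_eq0 x0; exists 0, y; rewrite add0r; split=> //.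
      by rewrite N_le rho0 mul1r ltW.
    have [z zE Sz] := surj _ x0.
    have [y yE] : exists y, x - z = y *+ 3.
      by apply: red3_eq0; rewrite [red3 _]map_mxB [map_mx _ x]zE; exact: subrr.
    exists z, y; rewrite -yE addrC subrK; split=> //; rewrite N_le mul1r.
    by apply/rhoP; case: ((wdP _).1 Sz).
have [U Uu NU] := extremal_norm_cube eN; exists U => // c cbox.
by apply/rhoP; rewrite -[w]mul1r -N_le NU.
Qed.

End WidthCube.

(** * Convex hulls and cross-polytopes *)

Section Convexity.
Variables (R : realType) (d : nat).
Implicit Types (A S : set 'rV[R]_d) (v : functional R d) (x y : 'rV[R]_d).

Lemma convex_setP A : convex_set A <-> forall x y (t : R), 0 <= t -> t <= 1 ->
  A x -> A y -> A (t *: x + (1 - t) *: y).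
Proof.
split=> [cA x y t t0 t1 Ax Ay|cA x y t].
  by have := cA x y (Itv01 t0 t1); rewrite !inE; apply.
by rewrite !inE => Ax Ay; apply: cA.
Qed.

Lemma convex_hull_sub S : S `<=` convex_hull S.
Proof. exact: sub_gen_smallest. Qed.

Lemma convex_hull_convex S :
  convex_set (convex_hull S : set (convex_lmodType 'rV[R]_d)).
Proof.
apply/convex_setP => x y t t0 t1 Sx Sy A [cA SA].
by move/convex_setP: (cA); apply => //; [exact: Sx|exact: Sy].
Qed.

Lemma convex_sum A (I : finType) (t : I -> R) (p : I -> 'rV[R]_d) :
  convex_set A -> (forall i, 0 <= t i) -> \sum_i t i = 1 -> (forall i, A (p i)) ->
  A (\sum_i t i *: p i).
Proof.
move=> /convex_setP cA t0 t1 Ap.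
(* The induction runs over partial sums normalised by their total weight; a tail of weight 0 is
   treated apart to avoid dividing by 0. *)
suff key (r : seq I) : 0 < \sum_(i <- r) t i ->
    A ((\sum_(i <- r) t i)^-1 *: \sum_(i <- r) t i *: p i).
  by have := key (index_enum I); rewrite t1 invr1 scale1r; apply.
elim: r => [|i r IHr]; first by rewrite big_nil ltxx.
rewrite !big_cons; set T := \sum_(j <- r) t j in IHr *.
have : 0 <= T by rewrite sumr_ge0.
rewrite le_eqVlt => /predU1P[/esym/eqP T0|T0 tT0].
  have tr j : j \in r -> t j = 0.
    by move=> jr; move: T0; rewrite psumr_eq0 // => /allP/(_ j jr)/eqP.
  rewrite (eqP T0) addr0 => ti0; rewrite big1_seq ?addr0.
    by rewrite scalerA mulVf ?gt_eqF // scale1r.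
  by move=> j /andP[_ /tr ->]; rewrite scale0r.
have -> : (t i + T)^-1 *: (t i *: p i + \sum_(j <- r) t j *: p j) =
    (t i / (t i + T)) *: p i +
    (1 - t i / (t i + T)) *: (T^-1 *: \sum_(j <- r) t j *: p j).
  rewrite scalerDr !scalerA mulrC; congr (_ + _ *: _).
  by field; rewrite !gt_eqF.
apply: cA => //; last exact: IHr.
  by rewrite divr_ge0 // ltW.
by rewrite ler_pdivrMr // mul1r lerDl ltW.
Qed.

Lemma functional_continuous v : continuous (fun x => v x : R).
Proof.
rewrite (_ : (fun x => v x : R) = (fun x => \sum_i x 0 i * v 'e_i)); last first.
  by apply/funext => x; rewrite functional_coord.
apply: continuous_big => [|i _ x]; first exact: add_continuous.
by apply: cvgMr_tmp; [exact: (nbhs_filter x)|exact: coord_continuous].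
Qed.

Lemma closure_halfspace S v r : (forall x, S x -> (v x : R) <= r) ->
  forall x, closure (convex_hull S) x -> (v x : R) <= r.
Proof.
move=> Sr; pose H := [set x | (v x : R) <= r].
have SH : convex_hull S `<=` H.
  apply: smallest_sub => //; apply/convex_setP => x y t t0 t1; rewrite /H /= => xr yr.
  rewrite linearD !linearZ /= (_ : r = t * r + (1 - t) * r); last by ring.
  by apply: lerD; apply: ler_wpM2l; rewrite ?subr_ge0.
have closedH : closed H.
  apply: (closed_comp (f := fun x => v x : R)) (@closed_le R r) => x _.
  exact: functional_continuous.
by move=> x /(closure_subset SH); rewrite -(closure_id _).1.
Qed.

Lemma closure_normP A x : closure A x <->
  forall eps : R, 0 < eps -> exists2 y, A y & `|x - y| < eps.
Proof.
split=> [Ax eps eps0|Ax B].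
  have /Ax[y [Ay xy]] : nbhs x [set z | `|x - z| < eps].
    by apply/nbhs_ballP; exists eps => //= y; rewrite mx_norm_ball.
  by exists y.
move=> /nbhs_ballP[eps eps0 xB]; have [y Ay xy] := Ax eps eps0.
by exists y; split=> //; apply: xB; rewrite mx_norm_ball.
Qed.

Lemma closure_convex A : convex_set (A : set (convex_lmodType 'rV[R]_d)) ->
  convex_set (closure A : set (convex_lmodType 'rV[R]_d)).
Proof.
move=> /convex_setP cA; apply/convex_setP => x y t t0 t1.
move=> /closure_normP Ax /closure_normP Ay.
apply/closure_normP => eps eps0.
have [x' Ax' xx'] := Ax _ eps0; have [y' Ay' yy'] := Ay _ eps0.
exists (t *: x' + (1 - t) *: y'); first exact: cA.
rewrite opprD addrACA -!scalerBr (le_lt_trans (ler_normD _ _)) // !normrZ.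
rewrite ger0_norm // ger0_norm ?subr_ge0 //.
have [->|t_neq0] := eqVneq t 0; first by rewrite mul0r add0r subr0 mul1r.
have t_gt0 : 0 < t by rewrite lt_neqAle eq_sym t_neq0.
have : t * `|x - x'| < t * eps by rewrite ltr_pM2l.
have : (1 - t) * `|y - y'| <= (1 - t) * eps by rewrite ler_wpM2l ?subr_ge0 // ltW.
lra.
Qed.

Lemma convex_cross_polytope_sub A (x0 : 'rV[R]_d) (lam : R) (e : 'I_d -> 'rV[R]_d)
    (y : 'I_d -> R) : (0 < d)%N -> 0 < lam ->
  convex_set (A : set (convex_lmodType 'rV[R]_d)) ->
  (forall i, A (x0 + lam *: e i)) -> (forall i, A (x0 - lam *: e i)) ->
  \sum_i `|y i| <= lam -> A (x0 + \sum_i y i *: e i).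
Proof.
move=> d0 lam0 cA Ap Am ylam.
(* The vertices along [e i] get the positive and negative parts of [y i / lam] as weights. The
   weight then missing from 1 is shared equally, [s] per axis, and halved between opposite vertices
   so that it only contributes to the centre. *)
pose s : R := (1 - (\sum_i `|y i|) / lam) / d%:R.
have dR : 0 < d%:R :> R by rewrite ltr0n.
have s0 : 0 <= s by rewrite divr_ge0 ?ler0n // subr_ge0 ler_pdivrMr // mul1r.
pose sg (b : bool) : R := (-1) ^+ b.
pose t (ib : 'I_d * bool) := ((`|y ib.1| + sg ib.2 * y ib.1) / lam + s) / 2.
pose p (ib : 'I_d * bool) := x0 + (sg ib.2 * lam) *: e ib.1.
have t1 : \sum_ib t ib = 1.
  rewrite -(pair_bigA _ (fun i b => t (i, b))) /=.
  under eq_bigr => i _.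
    rewrite big_bool /t /sg /=.
    have -> : ((`|y i| + (-1) ^+ true * y i) / lam + s) / 2 +
      ((`|y i| + (-1) ^+ false * y i) / lam + s) / 2 = `|y i| / lam + s.
      by rewrite expr0 expr1; field; rewrite gt_eqF.
    over.
  rewrite big_split /= -mulr_suml sumr_const card_ord -mulr_natr.
  by rewrite /s; field; rewrite !gt_eqF.
have -> : x0 + \sum_i y i *: e i = \sum_ib t ib *: p ib.
  under [RHS]eq_bigr do rewrite scalerDr.
  rewrite big_split /= -scaler_suml t1 scale1r; congr (_ + _).
  rewrite -(pair_bigA _ (fun i b => t (i, b) *: ((sg b * lam) *: e i))) /=.
  apply: eq_bigr => i _; rewrite big_bool /t /sg /= !scalerA -scalerDl; congr (_ *: _).
  by rewrite expr0 expr1; field; rewrite gt_eqF.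
apply: convex_sum => // [[i b]|[i b]]; rewrite /t /p /sg /=.
  rewrite divr_ge0 // addr_ge0 //; apply: divr_ge0; last exact: ltW.
  case: b; rewrite ?expr1 ?expr0 ?mulN1r ?mul1r.
    by rewrite subr_ge0 ler_norm.
  by have := ler_norm (- y i); rewrite normrN; lra.
case: b; rewrite ?expr1 ?expr0 ?mulN1r ?mul1r //; first by rewrite scaleNr.
Qed.

(** The [g i] are the coordinates in the basis [e]. Points of [S] satisfy an l1 bound, so one with a
    signed coordinate near [lam] has all others near 0: it approaches a vertex. *)
Lemma closure_convex_hull_cross_polytope S (x0 : 'rV[R]_d) (lam : R)
    (e : 'I_d -> 'rV[R]_d) (g : 'I_d -> functional R d) :
  (0 < d)%N -> 0 < lam -> (forall x, x = \sum_i (g i x : R) *: e i) ->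
  (forall x, S x -> \sum_i `|g i (x - x0) : R| <= lam) ->
  (forall i (s eps : R), `|s| = 1 -> 0 < eps ->
     exists2 x, S x & lam - eps < s * (g i (x - x0) : R)) ->
  closure (convex_hull S) =
  convex_hull ([set x0 + lam *: e i | i in [set: 'I_d]] `|`
               [set x0 - lam *: e i | i in [set: 'I_d]]).
Proof.
move=> d0 lam0 eg Sle Sge; apply/seteqP; split=> x.
  move=> Sx; have -> : x = x0 + \sum_i (g i (x - x0) : R) *: e i.
    by rewrite -eg addrC subrK.
  apply: (@convex_cross_polytope_sub _ x0 lam e) => // [|i|i|].
  - exact: convex_hull_convex.
  - by apply: convex_hull_sub; left; exists i.
  - by apply: convex_hull_sub; right; exists i.
  (* Signs are chosen so that [v (x - x0)] is the l1 norm at this [x]; on [S] the same functional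
     stays below [lam], and half-spaces pass to the closed convex hull. *)
  pose v : functional R d := \sum_i Num.sg (g i (x - x0) : R) *: g i.
  have vE z : v (z - x0) = \sum_i Num.sg (g i (x - x0) : R) * g i (z - x0) :> R.
    by rewrite /v sum_lfunE; apply: eq_bigr => i _; rewrite scale_lfunE.
  have : (v x : R) <= lam + v x0.
    apply: closure_halfspace Sx => z Sz; rewrite -lerBlDr.
    have -> : (v z : R) - v x0 = v (z - x0) by rewrite linearB.
    rewrite vE (le_trans _ (Sle z Sz)) //; apply: ler_sum => i _.
    rewrite (le_trans (ler_norm _)) // normrM normr_sg.
    by case: (_ != 0); rewrite ?mul1r ?mul0r.
  rewrite -lerBlDr; have -> : (v x : R) - v x0 = v (x - x0) by rewrite linearB.
  rewrite vE; suff -> : \sum_i `|g i (x - x0) : R| =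
      \sum_i Num.sg (g i (x - x0) : R) * g i (x - x0) :> R by [].
  by apply: eq_bigr => i _; rewrite normrEsg.
move: x; have cS := closure_convex (@convex_hull_convex S).
have vertex i (s : R) : `|s| = 1 -> closure (convex_hull S) (x0 + (s * lam) *: e i).
  move=> s1; apply/closure_normP => eps eps0.
  (* Coordinate errors of at most [eps / K] add up to a vector of norm below [eps]; the summand 1
     makes [K] positive and the bound strict. *)
  pose K := 1 + \sum_j `|e j|.
  have K0 : 0 < K by rewrite ltr_pwDl // sumr_ge0.
  have [x Sx xi] := Sge i s (eps / K) s1 (divr_gt0 eps0 K0).
  exists x; first exact: convex_hull_sub.
  have := Sle x Sx; set y := fun j => g j (x - x0) : R => yle.
  have -> : x0 + (s * lam) *: e i - x = \sum_j ((s * lam) *+ (j == i) - y j) *: e j.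
    under eq_bigr do rewrite scalerBl.
    rewrite sumrB -eg (bigD1 i) //= eqxx big1 => [|j /negPf ->]; last by rewrite scale0r.
    by rewrite addr0 opprB addrCA addrA.
  have yi : `|y i| <= lam - \sum_(j | j != i) `|y j|.
    by move: yle; rewrite (bigD1 i) //= lerBrDr.
  have sy : s * y i <= `|y i| by rewrite (le_trans (ler_norm _)) // normrM s1 mul1r.
  have y'0 : 0 <= \sum_(j | j != i) `|y j| by rewrite sumr_ge0.
  have coef j : `|(s * lam) *+ (j == i) - y j| <= eps / K.
    have [->|ji] := eqVneq j i.
      have ss : s * s = 1 by rewrite -expr2 -real_normK ?num_real // s1 expr1n.
      have -> : (s * lam) *+ true - y i = s * (lam - s * y i).
        by rewrite mulrBr mulrA ss mul1r.
      rewrite normrM s1 mul1r ger0_norm; move: xi; rewrite -/(y i); lra.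
    rewrite mulr0n sub0r normrN.
    have : `|y j| <= \sum_(j | j != i) `|y j|.
      by rewrite (bigD1 j) //= lerDl sumr_ge0.
    move: xi; rewrite -/(y i); lra.
  rewrite (le_lt_trans (ler_norm_sum _ _ _)) //.
  apply: (@le_lt_trans _ _ (eps / K * \sum_j `|e j|)).
    rewrite mulr_sumr; apply: ler_sum => j _; rewrite normrZ.
    by rewrite ler_wpM2r.
  by rewrite mulrAC ltr_pdivrMr // ltr_pM2l // /K; lra.
apply: smallest_sub => // z [[i _ <-]|[i _ <-]].
  by have := vertex i 1 (normr1 _); rewrite mul1r.
by have := vertex i (-1); rewrite normrN1 mulN1r scaleNr; apply.
Qed.

End Convexity.

(* Comparing the diagonals of the parallelogram spanned by [a] and [u] shows that
   [g (a + u) = g (- a - u)] as soon as this symmetry holds at [a] and [u]. *)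
Lemma unit_box_symmetric (R : realFieldType) d (g : 'rV[int]_d -> R) (w : R) :
  (forall a u, unit_box a -> unit_box (a + u) -> unit_box (a - u) ->
     2 * g a <= g (a + u) + g (a - u)) ->
  (forall c, unit_box c -> c != 0 -> g c + g (- c) = w) ->
  (forall i, g 'e_i = w / 2) ->
  forall c, unit_box c -> c != 0 -> g c = w / 2.
Proof.
move=> mid opp gdelta c.
(* Induction on the number [n] of leading coordinates that may be nonzero. *)
suff key n : unit_box c -> c != 0 -> (forall i : 'I_d, (n <= i)%N -> c 0 i = 0) ->
    g c = w / 2.
  by move=> cbox c0; apply: (key d) => // i; rewrite leqNgt ltn_ord.
have boxN (b : 'rV[int]_d) : unit_box b -> unit_box (- b).
  by move=> bb i; rewrite mxE normrN.
elim: n c => [|n IHn] c cbox c0 cn.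
  by case/eqP: c0; apply/rowP=> i; rewrite cn // mxE.
have [dn|nd] := leqP d n.
  by apply: IHn => // i ni; have := ltn_ord i; lia.
pose j := Ordinal nd.
have cjn (i : 'I_d) : (n <= i)%N -> i != j -> c 0 i = 0.
  by move=> ni ij; apply: cn; rewrite ltn_neqAle ni andbT eq_sym.
have [cj0|cj0] := eqVneq (c 0 j) 0.
  apply: IHn => // i ni; have [->|ij] := eqVneq i j; [exact: cj0|exact: cjn].
(* The last nonzero coordinate is split off; [a - u] merely flips its sign and so stays in the
   box. *)
pose u : 'rV[int]_d := c 0 j *: 'e_j; pose a := c - u.
have uE i : u 0 i = c 0 j *+ (i == j) by rewrite !mxE eqxx mulr_natr.
have aE i : a 0 i = c 0 i *+ (i != j).
  by rewrite 2!mxE uE; case: eqVneq => [->|_]; rewrite ?subrr ?mulr0n ?subr0.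
have amuE i : (a - u) 0 i = a 0 i - u 0 i by rewrite mxE [(- u) _ _]mxE.
have ubox : unit_box u by move=> i; rewrite uE; case: (i == j); [exact: cbox|].
have abox : unit_box a by move=> i; rewrite aE; case: (i != j); [exact: cbox|].
have u0 : u != 0.
  apply/eqP => /rowP/(_ j); rewrite uE eqxx mulr1n [RHS]mxE => /eqP; exact/negP.
have gu : g u = w / 2.
  have : `|c 0 j| <= 1 := cbox j.
  have := opp u ubox u0; rewrite /u; move: (c 0 j) cj0 => k k0.
  move=> + k1; have [->|->] : k = 1 \/ k = -1 by lia.
    by rewrite scale1r.
  by rewrite scaleN1r opprK gdelta; lra.
have cau : c = a + u by rewrite subrK.
have [a0|a0] := eqVneq a 0; first by rewrite cau a0 add0r.
have ga : g a = w / 2.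
  apply: IHn => // i ni; rewrite aE; case: eqVneq => //= ij.
  by rewrite mulr1n; exact: cjn.
have aubox : unit_box (a + u) by rewrite -cau.
have amubox : unit_box (a - u).
  move=> i; rewrite amuE aE uE; case: eqVneq => _ /=.
    by rewrite mulr0n sub0r normrN; exact: cbox.
  by rewrite mulr0n subr0; exact: cbox.
have amu0 : a - u != 0.
  apply/eqP => /rowP/(_ j); rewrite amuE aE uE eqxx [RHS]mxE mulr0n mulr1n => /eqP.
  by rewrite sub0r oppr_eq0; exact/negP.
have au0 : a + u != 0 by rewrite -cau.
have := opp _ aubox au0; have := opp _ amubox amu0.
have := opp _ abox a0; have := opp _ ubox u0.
(* With [p = g (a + u)] and [q = g (a - u)], the midpoint inequalities at [a], [u], [- a], [- u]
   read [w <= p + q], [q <= p], [p + q <= w] and [p <= q]. *)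
have := mid _ _ abox aubox amubox.
have := mid u a ubox; rewrite (addrC u) -opprB => /(_ aubox (boxN _ amubox)).
have := mid (- a) u (boxN _ abox); rewrite (addrC (- a) u) -(opprB a u) -opprD.
move=> /(_ (boxN _ amubox) (boxN _ aubox)).
have := mid (- u) a (boxN _ ubox); rewrite (addrC (- u) a) -opprD (addrC u a).
move=> /(_ amubox (boxN _ aubox)).
rewrite cau ga gu; lra.
Qed.

(** * Lattice bases and unimodular matrices *)

Section LatticeBasis.
Variables (R : realType) (d : nat).

Lemma int_comb (e : 'I_d -> 'rV[R]_d) (E : 'M[int]_d) (c : {ffun 'I_d -> int}) :
  (forall i, e i = map_mx intr (row i E)) ->
  \sum_(i < d) e i *~ c i = map_mx intr (\row_i c i *m E).
Proof.
move=> eE; rewrite mulmx_sum_row map_mx_sum; apply: eq_bigr => i _.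
by rewrite mxE map_mxZ -eE scaler_int.
Qed.

Lemma map_intr_inj (m n : nat) :
  injective (map_mx (intr : int -> R) : 'M[int]_(m, n) -> _).
Proof.
move=> x y /matrixP xy; apply/matrixP => i j; apply/eqP.
by rewrite -(eqr_int R); have := xy i j; rewrite !mxE => ->.
Qed.

(** Expanding the standard basis vectors in the family [e] produces an integral inverse of its
    matrix. *)
Lemma lattice_basisP (e : 'I_d -> 'rV[R]_d) :
  lattice_basis e <->
  exists2 E : 'M[int]_d, E \in unitmx & forall i, e i = map_mx intr (row i E).
Proof.
split=> [[eint ebasis]|[E Eu eE]].
  have /choice[f fE] : forall i, exists z, e i = map_mx intr z.
    by move=> i; exact: ZlatticeP.
  pose E := \matrix_i f i; have eE i : e i = map_mx intr (row i E) by rewrite rowK.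
  exists E => //; have /choice[c cE] : forall j, exists c : {ffun 'I_d -> int},
      \row_i c i *m E = 'e_j.
    move=> j; have [c [cj _]] := ebasis _ (@Zlattice_map R d 'e_j).
    by exists c; apply: map_intr_inj; rewrite -(int_comb _ eE) -cj.
  have : (\matrix_(j, i) c j i) *m E = 1%:M.
    apply/row_matrixP => j; rewrite row_mul row1 -cE; congr (_ *m _).
    by apply/rowP=> i; rewrite !mxE.
  by case/mulmx1_unit.
split=> [i|z /ZlatticeP[z0 ->]]; first by rewrite eE; exact: Zlattice_map.
exists [ffun i => (z0 *m invmx E) 0 i]; split.
  rewrite (int_comb _ eE); congr map_mx; rewrite -[LHS](mulmxKV Eu); congr (_ *m _).
  by apply/rowP=> i; rewrite [RHS]mxE ffunE.
move=> c; rewrite (int_comb _ eE) => /map_intr_inj ->.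
by apply/ffunP=> i; rewrite ffunE mulmxK // mxE.
Qed.

End LatticeBasis.

(** * Widths of cross-polytopes *)

Section CrossPolytope.
Variables (R : realType) (d : nat).
Implicit Types (S : set 'rV[R]_d) (v : functional R d).

Lemma osc_le_closure_hull S v r :
  osc_le S v r -> osc_le (closure (convex_hull S)) v r.
Proof.
move=> vr x y Px Py.
have Sx z : S z -> (v x : R) - v z <= r.
  move=> Sz; rewrite lerBlDr; apply: closure_halfspace Px => t St.
  by rewrite -lerBlDr vr.
suff : ((- v) y : R) <= r - v x by rewrite opp_lfunE; lra.
apply: closure_halfspace Py => z Sz; rewrite opp_lfunE.
have := Sx z Sz; lra.
Qed.

Lemma osc_le_sub S S' v r : S `<=` S' -> osc_le S' v r -> osc_le S v r.
Proof. by move=> SS' vr x y /SS' Sx /SS' Sy; exact: vr. Qed.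

Lemma intfun_map (z x : 'rV[int]_d) :
  intfun R z (map_mx intr x) = ((x *m z^T) 0 0)%:~R :> R.
Proof.
rewrite intfunE mxE rmorph_sum; apply: eq_bigr => i _.
by rewrite !mxE rmorphM.
Qed.

(** Oscillation does not change on passing to the closed convex hull, so it can be read off the
    vertices. The absolute value of [lam] appears because its sign is arbitrary. *)
Lemma cross_polytope_osc_le S (x0 : 'rV[R]_d) (lam : R) (e : 'I_d -> 'rV[R]_d) v r :
  closure (convex_hull S) =
    convex_hull ([set x0 + lam *: e i | i in [set: 'I_d]] `|`
                 [set x0 - lam *: e i | i in [set: 'I_d]]) ->
  osc_le S v r <-> forall i, 2 * `|lam| * `|v (e i) : R| <= r.
Proof.
set V := _ `|` _ => PV.
have vp i : v (x0 + lam *: e i) = (v x0 : R) + lam * v (e i) :> R.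
  by rewrite linearD linearZ.
have vm i : v (x0 - lam *: e i) = (v x0 : R) - lam * v (e i) :> R.
  by rewrite linearB linearZ.
split=> [vr i|vr].
  have Vr : osc_le V v r.
    apply: osc_le_sub (osc_le_closure_hull vr); rewrite PV; exact: convex_hull_sub.
  have Vp : V (x0 + lam *: e i) by left; exists i.
  have Vm : V (x0 - lam *: e i) by right; exists i.
  have := Vr _ _ Vp Vm; have := Vr _ _ Vm Vp; rewrite vp vm -mulrA -normrM.
  by case: ger0P; lra.
have vr' i : `|lam * v (e i)| <= r / 2.
  by have := vr i; rewrite -mulrA -normrM; lra.
have Vr : osc_le V v r.
  have abs i : lam * v (e i) <= r / 2 /\ - (lam * v (e i)) <= r / 2.
    by have := vr' i; rewrite ler_norml => /andP[h1 h2]; split=> //; rewrite lerNl.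
  move=> x y [[i _ <-]|[i _ <-]] [[j _ <-]|[j _ <-]]; rewrite ?vp ?vm;
    have := abs i; have := abs j; lra.
apply: osc_le_sub (osc_le_closure_hull Vr) => x Sx; apply: subset_closure.
by rewrite -PV; apply: subset_closure; exact: convex_hull_sub.
Qed.

Lemma cross_polytope_width_card S : (1 <= d)%N -> S !=set0 ->
  affine_hull S = [set: 'rV[R]_d] ->
  regular_lattice_cross_polytope (closure (convex_hull S)) ->
  width_directions S #= `I_(3 ^ d - 1).
Proof.
move=> d1 S0 hullS [x0 [lam [e [/lattice_basisP[E Eu eE] PE]]]].
have osc v r := cross_polytope_osc_le v r PE.
have vE (z : 'rV[int]_d) i : intfun R z (e i) = ((z *m E^T) 0 i)%:~R :> R.
  rewrite eE intfun_map; congr (_%:~R); rewrite !mxE; apply: eq_bigr => k _.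
  by rewrite !mxE mulrC.
have ETu : E^T \in unitmx by rewrite unitmx_tr.
(* If [lam] were 0, every functional would be constant on [S], against full dimension. *)
have lam0 : 0 < 2 * `|lam|.
  rewrite mulr_gt0 // normr_gt0; apply/eqP => lam0.
  have /intfun_neq0 : ('e_(Ordinal d1) : 'rV[int]_d) != 0.
    by apply/eqP => /rowP/(_ (Ordinal d1)); rewrite !mxE !eqxx.
  apply; apply: (osc_le0 S0 hullS); apply/osc => i.
  by rewrite lam0 normr0 mulr0 mul0r.
(* [f c] has coordinates [c] in the basis dual to [e], so its width is [2 * |lam|] times the largest
   [|c 0 i|]. *)
pose f c : functional R d := intfun R (c *m invmx E^T).
have fE c i : f c (e i) = (c 0 i)%:~R :> R by rewrite vE mulmxKV.
have f_dual c : dual_lattice (f c) by apply/dual_latticeP; exists (c *m invmx E^T).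
have f_inj : injective f.
  by move=> c c' /intfun_inj/(congr1 (mulmx^~ E^T)); rewrite !mulmxKV.
have f0 : f 0 = 0 by rewrite /f mul0mx intfun0.
have f_osc c : unit_box c -> osc_le S (f c) (2 * `|lam|).
  move=> cbox; apply/osc => i; rewrite fE ger_pMr // -intr_norm lerz1.
  exact: cbox.
have w_min v r : dual_lattice v -> v <> 0 -> osc_le S v r -> 2 * `|lam| <= r.
  move=> /dual_latticeP[z ->] z0 /osc zr.
  have [i zi] : exists i, (z *m E^T) 0 i != 0.
    apply/existsP; apply: contra_notT z0; rewrite negb_exists => /forallP zE0.
    suff -> : z = 0 by rewrite intfun0.
    rewrite -[z](mulmxK ETu) (_ : z *m E^T = 0) ?mul0mx //.
    by apply/rowP=> i; have := zE0 i; rewrite negbK => /eqP ->; rewrite mxE.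
  rewrite (le_trans _ (zr i)) // vE -intr_norm; apply: ler_peMr; first exact: ltW.
  rewrite ler1z.
  by move: ((z *m E^T) 0 i) zi => k; lia.
have delta_box : unit_box ('e_(Ordinal d1) : 'rV[int]_d).
  by move=> i; rewrite !mxE; case: (_ && _).
have [wdP _] : is_lattice_width S (2 * `|lam|).
  apply: (is_lattice_widthP S0 w_min (f_dual 'e_(Ordinal d1)) _ (f_osc _ delta_box)).
  by rewrite -f0 => /f_inj/rowP/(_ (Ordinal d1)); rewrite !mxE !eqxx.
(* The digits 0, 1, 2 encode -1, 0, 1, so the excluded constant function 1 is the zero vector. *)
pose A := [set t : {ffun 'I_d -> 'I_3} | t != [ffun=> 1]].
have cardA : A #= `I_(3 ^ d - 1).
  have := card_finpred (predC1 ([ffun=> 1] : {ffun 'I_d -> 'I_3})).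
  by rewrite cardC1 card_ffun !card_ord subn1; apply.
pose h (t : {ffun 'I_d -> 'I_3}) : 'rV[int]_d := \row_i ((t i)%:Z - 1).
have h_inj : injective h.
  move=> t t' /rowP tt'; apply/ffunP => i; apply: val_inj.
  by have := tt' i; rewrite !mxE => /addIr[].
apply/card_eqPle; split; first exact: width_directions_card_le.
rewrite -(card_le_eql cardA).
apply: (@card_le_trans _ _ _ ((f \o h) @` A)).
  rewrite (card_le_eqr (inj_card_eq _)) ?card_lexx //.
  by move=> t t' _ _ /f_inj/h_inj.
apply: subset_card_le => _ [t /eqP t1 <-]; apply/wdP; split=> //=.
  rewrite -f0 => /f_inj/rowP ht; apply: t1; apply/ffunP => i; apply: val_inj.
  by have := ht i; rewrite !mxE ffunE => /eqP; rewrite subr_eq0 => /eqP[].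
by apply: f_osc => i; rewrite mxE; have := ltn_ord (t i); lia.
Qed.

End CrossPolytope.

(** * The equality case *)

Section Extremal.
Variables (R : realType) (d : nat).
Implicit Types (S : set 'rV[R]_d) (v : functional R d).

Definition support S v : R := sup [set (v x : R) | x in S].

Lemma support_ub S v r x : osc_le S v r -> S x -> (v x : R) <= support S v.
Proof.
move=> vr Sx; apply: ub_le_sup; last by exists x.
exists (r + v x) => _ [y Sy <-]; rewrite -lerBlDr; exact: vr.
Qed.

Lemma support_le S v r : S !=set0 -> (forall x, S x -> (v x : R) <= r) ->
  support S v <= r.
Proof.
move=> [x Sx] vr; apply: ge_sup; first by exists (v x), x.
by move=> _ [y Sy <-]; exact: vr.
Qed.

Lemma support_adherent S v r eps : S !=set0 -> osc_le S v r -> 0 < eps ->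
  exists2 x, S x & support S v - eps < v x.
Proof.
move=> S0 vr eps0; apply: contrapT => noadh.
suff : support S v <= support S v - eps by rewrite lerBrDr; lra.
apply: support_le => // x Sx; rewrite leNgt; apply/negP => lt_x.
by apply: noadh; exists x.
Qed.

Lemma supportN S v w : S !=set0 -> osc_le S v w ->
  (forall r, osc_le S v r -> w <= r) -> support S v + support S (- v) = w.
Proof.
move=> S0 vw w_min; have vNw := osc_leN vw; apply: le_anti; apply/andP; split.
  rewrite -lerBrDr; apply: support_le => // x Sx; rewrite lerBrDr addrC -lerBrDr.
  apply: support_le => // y Sy; rewrite opp_lfunE.
  by have := vw _ _ Sx Sy; lra.
apply: w_min => x y Sx Sy; apply: lerD; first exact: support_ub vw Sx.
by rewrite -opp_lfunE; exact: support_ub vNw Sy.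
Qed.

(** Subadditivity of the support function applied to [(v + v') + (v - v')]. *)
Lemma support_mid S v v' r r' : S !=set0 -> osc_le S (v + v') r ->
  osc_le S (v - v') r' ->
  2 * support S v <= support S (v + v') + support S (v - v').
Proof.
move=> S0 vr vr'; rewrite -ler_pdivlMl //; apply: support_le => // x Sx.
rewrite ler_pdivlMl //; have := support_ub vr Sx; have := support_ub vr' Sx.
rewrite !add_lfunE opp_lfunE; lra.
Qed.

Lemma width_card_cross_polytope S : (1 <= d)%N -> S !=set0 ->
  affine_hull S = [set: 'rV[R]_d] -> width_directions S #= `I_(3 ^ d - 1) ->
  regular_lattice_cross_polytope (closure (convex_hull S)).
Proof.
move=> d1 S0 hullS cardS.
have [w [w0 wP] [U Uu Uosc]] := lattice_width_cube d1 S0 hullS cardS.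
pose F (c : 'rV[int]_d) := intfun R (c *m U).
have FD c c' : F (c + c') = F c + F c' by rewrite /F mulmxDl intfunD.
have FN c : F (- c) = - F c by rewrite /F mulNmx intfunN.
have Fmin c r : c != 0 -> osc_le S (F c) r -> w <= r.
  move=> c0; apply: wP.2; first by apply/dual_latticeP; exists (c *m U).
  apply: intfun_neq0; apply: contraNneq c0 => cU0.
  by rewrite -[c](mulmxK Uu) cU0 mul0mx.
(* The inverse transpose makes [e] the basis dual to the functionals [g]. *)
pose g i := F 'e_i; pose E := (invmx U)^T; pose e i : 'rV[R]_d := map_mx intr (row i E).
have gE x : \row_i (g i x : R) = x *m map_mx intr U^T.
  apply/rowP=> i; rewrite mxE /g /F -rowE intfunE mxE; apply: eq_bigr => k _.
  by rewrite !mxE.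
have FE c x : F c x = \sum_i (c 0 i)%:~R * g i x :> R.
  rewrite /F intfunE; under eq_bigr do rewrite mxE rmorph_sum mulr_sumr.
  rewrite exchange_big; apply: eq_bigr => i _.
  rewrite /g /F -rowE intfunE mulr_sumr; apply: eq_bigr => k _.
  by rewrite !mxE rmorphM mulrCA.
have eE (a : 'rV[R]_d) : \sum_i a 0 i *: e i = a *m map_mx intr E.
  by rewrite mulmx_sum_row; apply: eq_bigr => i _; rewrite /e map_row.
have UE : map_mx intr U^T *m map_mx intr E = 1%:M :> 'M[R]_d.
  by rewrite -map_mxM -trmx_mul mulVmx // trmx1 map_mx1.
have EU : map_mx intr E *m map_mx intr U^T = 1%:M :> 'M[R]_d.
  by rewrite -map_mxM -trmx_mul mulmxV // trmx1 map_mx1.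
have eg x : x = \sum_i (g i x : R) *: e i.
  rewrite -[LHS]mulmx1 -UE mulmxA -eE.
  by apply: eq_bigr => i _; rewrite -gE mxE.
have delta_box i : unit_box ('e_i : 'rV[int]_d).
  by move=> j; rewrite !mxE; case: (_ && _).
have delta0 i : ('e_i : 'rV[int]_d) != 0.
  by apply/eqP => /rowP/(_ i); rewrite !mxE !eqxx.
pose H c := support S (F c).
have HN c : unit_box c -> c != 0 -> H c + H (- c) = w.
  move=> cbox c0; rewrite /H FN; apply: supportN => //; first exact: Uosc.
  by move=> r; exact: Fmin.
(* [a 0 i] is the midpoint of the range of [g i] on [S], and [x0] is the point with these
   coordinates: the centre. *)
pose a : 'rV[R]_d := \row_i ((H 'e_i - H (- 'e_i)) / 2).
pose x0 : 'rV[R]_d := a *m map_mx intr E.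
have gx0 i : g i x0 = a 0 i :> R.
  have /rowP/(_ i) := gE x0; rewrite mxE => ->.
  by rewrite /x0 -mulmxA EU mulmx1.
have Hw c : unit_box c -> c != 0 -> H c - F c x0 = w / 2.
  apply: (unit_box_symmetric (g := fun c => H c - (F c x0 : R)) (w := w)).
  - move=> b u bbox bubox bmubox; rewrite /H !FD FN !add_lfunE opp_lfunE.
    have Fp : osc_le S (F b + F u) w by rewrite -FD; exact: Uosc.
    have Fm : osc_le S (F b - F u) w by rewrite -FN -FD; exact: Uosc.
    have := support_mid S0 Fp Fm; lra.
  - move=> b bbox b0; rewrite FN opp_lfunE; have := HN b bbox b0; lra.
  - move=> i; have := gx0 i; rewrite /g => ->; rewrite mxE.
    have := HN _ (delta_box i) (delta0 i); lra.
have boxN (b : 'rV[int]_d) : unit_box b -> unit_box (- b).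
  by move=> bb i; rewrite mxE normrN.
exists x0, (w / 2), e; split.
  by apply/lattice_basisP; exists E; rewrite // unitmx_tr unitmx_inv.
apply: (closure_convex_hull_cross_polytope (g := g)) => //; first by rewrite divr_gt0.
(* For the sign vector [c], the value [F c (x - x0)] is the l1 norm of the coordinates, bounded by
   the centred support function. *)
- move=> x Sx; pose c : 'rV[int]_d := \row_i sgz (g i (x - x0) : R).
  have -> : \sum_i `|g i (x - x0) : R| = F c (x - x0).
    by rewrite FE; apply: eq_bigr => i _; rewrite mxE -sgrEz normrEsg.
  have cbox : unit_box c by move=> i; rewrite mxE; case: sgzP.
  have [->|c0] := eqVneq c 0.
    by rewrite /F mul0mx intfun0 zero_lfunE divr_ge0 // ltW.
  rewrite -(Hw c) // linearB /= lerB //; exact: (support_ub (Uosc _ cbox)).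
- move=> i s eps s1 eps0.
  have [c [cbox c0 cs]] : exists c, [/\ unit_box c, c != 0 &
      forall x, F c x = s * g i x :> R].
    have : s = 1 \/ s = -1.
      by move: s1; case: ger0P => _ h; [left|right]; rewrite // -h opprK.
    case=> ->.
      by exists 'e_i; split=> // x; rewrite mul1r.
    exists (- 'e_i); split; first exact: boxN.
      by rewrite oppr_eq0.
    by move=> x; rewrite FN opp_lfunE mulN1r.
  have [x Sx xE] := support_adherent S0 (Uosc _ cbox) eps0; exists x => //.
  rewrite -cs linearB /= -(Hw c) //; move: xE; rewrite /H -/(F c).
  rewrite -subr_gt0 => xE; rewrite -subr_gt0.
  by rewrite (_ : _ - _ = F c x - (support S (F c) - eps)) //; ring.
Qed.

End Extremal.

Theorem theorem1p1 (R : realType) (d : nat) (S : set 'rV[R]_d)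
    (d_ge1 : (1 <= d)%N) (S_nonempty : S !=set0)
    (S_full_dim : affine_hull S = [set: 'rV[R]_d]) :
  (width_directions S #<= `I_(3 ^ d - 1)%N) /\
  (width_directions S #= `I_(3 ^ d - 1)%N <->
   regular_lattice_cross_polytope (closure (convex_hull S))).
Proof.
split; first exact: width_directions_card_le.
by split; [exact: width_card_cross_polytope | exact: cross_polytope_width_card].
Qed.
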